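(* Let $R$ be an associative commutative ring with identity $1\ne0$. (i) The maps $\xi\colon K_0(R)^4\to K_0(R\mathbb{A})$ and $\eta\colon K_0(R\mathbb{A})\to K_0(R)^4$ defined by $$\xi\bigl([P_1],[P_2],[P_3],[P_4]\bigr)=[K_1(P_1)]+[K_2(P_2)]+[E_{a_3}(P_3)]+[E_{a_4}(P_4)],$$ $$\eta([P])=\Bigl([S_{a_1}P],[S_{a_2}P],\bigl[\mathrm{coker}(P(f_{34})\colon P(a_4)\to P(a_3))\bigr],[S_{a_4}P]\Bigr)$$ are isomorphisms, inverse to one another. (ii) The map $\iota\colon U(\mathbb{A})\to K_0^f(R\mathbb{A})$ is bijective. If $R$ is a principal ideal domain, then the forgetful map $F^f\colon K_0^f(R\mathbb{A})\to K_0(R\mathbb{A})$ is bijective.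
   Context: $\mathbb{A}$ is the category with four objects $a_1,a_2,a_3,a_4$ and morphism sets $\mathrm{mor}(a_1,a_1)=\{\mathrm{id},f_{11}\}$, $\mathrm{mor}(a_1,a_2)=\{f_{12},g_{12}\}$, $\mathrm{mor}(a_1,a_3)=\{f_{13}\}$, $\mathrm{mor}(a_1,a_4)=\{f_{14}\}$, $\mathrm{mor}(a_2,a_1)=\{f_{21},g_{21}\}$, $\mathrm{mor}(a_2,a_2)=\{\mathrm{id},f_{22}\}$, $\mathrm{mor}(a_2,a_3)=\{f_{23}\}$, $\mathrm{mor}(a_2,a_4)=\{f_{24},g_{24}\}$, $\mathrm{mor}(a_3,a_1)=\{f_{31}\}$, $\mathrm{mor}(a_3,a_2)=\{f_{32}\}$, $\mathrm{mor}(a_3,a_3)=\{\mathrm{id}=f_{33}\}$, $\mathrm{mor}(a_3,a_4)=\{f_{34}\}$, $\mathrm{mor}(a_4,a_4)=\{\mathrm{id}=f_{44}\}$, and $\mathrm{mor}(a_4,a_j)=\emptyset$ for $j\ne4$. Composition: for non-identity morphisms $p\colon a_i\to a_j$ and $q\colon a_j\to a_k$, $q\circ p=f_{ik}$. An $R\mathbb{A}$-module is a functor $\mathbb{A}^{op}\to R\text{-Mod}$ (exactness objectwise). $R\,\mathrm{mor}(?,x)$ sends $y$ to the free $R$-module on $\mathrm{mor}(y,x)$. Finitely generated (f.g.) free: isomorphic to a finite direct sum of such modules; f.g. projective: direct summand of a f.g. free one. $K_0(R\mathbb{A})$ is the abelian group generated by isomorphism classes of f.g. projective $R\mathbb{A}$-modules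 modulo short exact sequences; $K_0^f(R\mathbb{A})$ is the Grothendieck group of f.g. free $R\mathbb{A}$-modules. $U(\mathbb{A})$ is the free abelian group on the set of isomorphism classes of objects of $\mathbb{A}$, and $\iota$ sends the basis element $\overline{x}$ to $[R\,\mathrm{mor}(?,x)]$. For an $R$-module $Q$ and $j\in\{3,4\}$, $E_{a_j}(Q):=Q\otimes_RR\,\mathrm{mor}(?,a_j)$. For $i\in\{1,2\}$, $K_i(Q)$ is the $R\mathbb{A}$-module with value $Q$ at $a_1$ and $a_2$ and value $0$ at $a_3$ and $a_4$, in which $g_{21}$ (if $i=1$), respectively $g_{12}$ (if $i=2$), induces $\mathrm{id}_Q$, and all other morphisms except $\mathrm{id}_{a_1},\mathrm{id}_{a_2}$ induce zero. $S_{a_i}P$ is the quotient of $P(a_i)$ by the submodule generated by the images of $P(u)\colon P(y)\to P(a_i)$ for all morphisms $u\colon a_i\to y$ which are not isomorphisms. *)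

(* Defs.v *)
From HB Require Import structures.
From mathcomp Require Import all_boot all_order all_algebra.
From mathcomp Require Import boolp.
From mathcomp.multinomials Require Import freeg.

Set Implicit Arguments.
Unset Strict Implicit.
Unset Printing Implicit Defensive.

Import GRing.Theory.
Local Open Scope ring_scope.
Local Open Scope quotient_scope.

(* -------------------------------------------------------------------- *)
(* The carrier of a K_0-group consists of (classes of expressions in)     *)
(* modules, so it lives in a larger universe than the carriers of the     *)
(* library's structures and cannot be a zmodType.  Hence this record.     *)

Record abGroup := AbGroup {
  ag_sort :> Type;
  ag0 : ag_sort;
  agD : ag_sort -> ag_sort -> ag_sort;
  agN : ag_sort -> ag_sort;
  agDA : associative agD;
  agDC : commutative agD;
  ag0D : left_id ag0 agD;
  agND : left_inverse ag0 agN agD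
}.
Arguments ag0 {a}.
Arguments agD {a} x y : rename.
Arguments agN {a} x : rename.

Declare Scope ag_scope.
Delimit Scope ag_scope with AG.
Notation "x + y" := (agD x y) : ag_scope.

Definition ag_hom (G H : abGroup) (f : G -> H) : Prop :=
  forall x y, f (x + y)%AG = (f x + f y)%AG.

Section AgProd.
Variables G H : abGroup.

Definition agprod_D (x y : G * H) := ((x.1 + y.1)%AG, (x.2 + y.2)%AG).
Definition agprod_N (x : G * H) := (agN x.1, agN x.2).

Lemma agprod_DA : associative agprod_D.
Proof. by case=> ? ? [? ?] [? ?]; rewrite /agprod_D /= !agDA. Qed.
Lemma agprod_DC : commutative agprod_D.
Proof. by case=> a b [c d]; rewrite /agprod_D /= (agDC a) (agDC b). Qed.
Lemma agprod_0D : left_id (ag0, ag0) agprod_D.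
Proof. by case=> a b; rewrite /agprod_D /= !ag0D. Qed.
Lemma agprod_ND : left_inverse (ag0, ag0) agprod_N agprod_D.
Proof. by case=> a b; rewrite /agprod_D /= !agND. Qed.

Definition agprod : abGroup :=
  AbGroup agprod_DA agprod_DC agprod_0D agprod_ND.

End AgProd.

Definition agpow4 (G : abGroup) : abGroup := agprod (agprod (agprod G G) G) G.

(* The quotient of T by e, as the type of the sets [e x]. *)
Definition eqclass (T : Type) (e : T -> T -> Prop) : Type :=
  {c : T -> Prop | exists x, c = e x}.

Definition eqclass_of (T : Type) (e : T -> T -> Prop) (x : T) : eqclass e :=
  exist _ (e x) (ex_intro _ x erefl).

(* The abelian group with generators T and relations r. *)

Inductive gexp (T : Type) : Type :=
| Gzero
| Ggen of T
| Gadd of gexp T & gexp T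
| Gopp of gexp T.
Arguments Gzero {T}.

Inductive gexp_eq (T : Type) (r : gexp T -> gexp T -> Prop) :
  gexp T -> gexp T -> Prop :=
| Geq_rel x y : r x y -> gexp_eq r x y
| Geq_refl x : gexp_eq r x x
| Geq_sym x y : gexp_eq r x y -> gexp_eq r y x
| Geq_trans x y z : gexp_eq r x y -> gexp_eq r y z -> gexp_eq r x z
| Geq_add x x' y y' :
    gexp_eq r x x' -> gexp_eq r y y' -> gexp_eq r (Gadd x y) (Gadd x' y')
| Geq_opp x x' : gexp_eq r x x' -> gexp_eq r (Gopp x) (Gopp x')
| Geq_addA x y z : gexp_eq r (Gadd x (Gadd y z)) (Gadd (Gadd x y) z)
| Geq_addC x y : gexp_eq r (Gadd x y) (Gadd y x)
| Geq_add0 x : gexp_eq r (Gadd Gzero x) x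
| Geq_addN x : gexp_eq r (Gadd (Gopp x) x) Gzero.

Section PresentedGroup.
Variables (T : Type) (r : gexp T -> gexp T -> Prop).
Local Notation car := (eqclass (gexp_eq r)).
Local Notation cls := (@eqclass_of _ (gexp_eq r)).

Definition pg_repr (c : car) : gexp T := projT1 (cid (proj2_sig c)).

Lemma pg_reprK c : cls (pg_repr c) = c.
Proof.
rewrite /pg_repr; case: cid => x /= e; case: c e => c hc /= e.
by subst c; rewrite /eqclass_of; congr exist; apply: Prop_irrelevance.
Qed.

Lemma pg_eq x y : gexp_eq r x y <-> cls x = cls y.
Proof.
split=> [xy|[exy]]; last by rewrite exy; apply: Geq_refl.
apply: eq_exist; apply: funext => z; apply: propext.
by split=> h; [apply: Geq_trans h; apply: Geq_sym | apply: Geq_trans h].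
Qed.

Lemma pg_repr_cls x : gexp_eq r (pg_repr (cls x)) x.
Proof. by apply/pg_eq; rewrite pg_reprK. Qed.

Definition pg_D (c d : car) : car := cls (Gadd (pg_repr c) (pg_repr d)).
Definition pg_N (c : car) : car := cls (Gopp (pg_repr c)).

Lemma pg_DE x y : pg_D (cls x) (cls y) = cls (Gadd x y).
Proof. by apply/pg_eq; apply: Geq_add; apply: pg_repr_cls. Qed.
Lemma pg_NE x : pg_N (cls x) = cls (Gopp x).
Proof. by apply/pg_eq; apply: Geq_opp; apply: pg_repr_cls. Qed.

Lemma pg_DA : associative pg_D.
Proof.
move=> x y z; rewrite -(pg_reprK x) -(pg_reprK y) -(pg_reprK z) !pg_DE.
by apply/pg_eq; apply: Geq_addA.
Qed.
Lemma pg_DC : commutative pg_D.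
Proof. by move=> x y; apply/pg_eq; apply: Geq_addC. Qed.
Lemma pg_0D : left_id (cls Gzero) pg_D.
Proof. by move=> x; rewrite -(pg_reprK x) pg_DE; apply/pg_eq/Geq_add0. Qed.
Lemma pg_ND : left_inverse (cls Gzero) pg_N pg_D.
Proof.
by move=> x; rewrite -(pg_reprK x) pg_NE pg_DE; apply/pg_eq/Geq_addN.
Qed.

Definition presGroup : abGroup := AbGroup pg_DA pg_DC pg_0D pg_ND.
Definition pgen (t : T) : presGroup := cls (Ggen t).

End PresentedGroup.

Definition freeAb (T : Type) : abGroup := presGroup (fun _ _ : gexp T => False).

(* [iso A B]: A and B are isomorphic; [ses A B C]: there is a short exact  *)
(* sequence 0 -> A -> B -> C -> 0.                                        *)
Inductive groth_rel (T : Type) (iso : T -> T -> Prop) (ses : T -> T -> T -> Prop) :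
  gexp T -> gexp T -> Prop :=
| groth_iso A B : iso A B -> groth_rel iso ses (Ggen A) (Ggen B)
| groth_ses A B C :
    ses A B C -> groth_rel iso ses (Ggen B) (Gadd (Ggen A) (Ggen C)).

Definition grothGroup (T : Type) (iso : T -> T -> Prop)
  (ses : T -> T -> T -> Prop) : abGroup := presGroup (groth_rel iso ses).

(* -------------------------------------------------------------------- *)
Section Submodules.
Variables (R : nzRingType) (V : lmodType R).

Definition lspan (S : V -> Prop) : {pred V} :=
  fun v => `[< forall W : submodClosed V, (forall s, S s -> s \in W) -> v \in W >].

Lemma lspan_submod_closed S : submod_closed (lspan S).
Proof.
split=> [|a u v]; first by apply/asboolP => W _; apply: rpred0.
move=> /asboolP hu /asboolP hv; apply/asboolP => W SW.
by rewrite rpredD ?rpredZ ?hu ?hv.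
Qed.

HB.instance Definition _ S :=
  GRing.isSubmodClosed.Build R V (lspan S) (lspan_submod_closed S).

Lemma mem_lspan (S : V -> Prop) v : S v -> v \in lspan S.
Proof. by move=> Sv; apply/asboolP => W; apply. Qed.

Variables (U : lmodType R) (f : {linear U -> V}).

Definition lin_img : {pred V} := fun v => `[< exists u, f u = v >].

Lemma lin_img_submod_closed : submod_closed lin_img.
Proof.
split=> [|a u v]; first by apply/asboolP; exists 0; rewrite linear0.
move=> /asboolP[x <-] /asboolP[y <-]; apply/asboolP.
by exists (a *: x + y); rewrite linearP.
Qed.

HB.instance Definition _ :=
  GRing.isSubmodClosed.Build R V lin_img lin_img_submod_closed.

End Submodules.

Section QuotientModule.
Variables (R : nzRingType) (V : lmodType R) (I : submodClosed V).

(* submodClosed does not record the closure under opposite, which the      *)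
(* library's quotient of a zmodType asks for.                             *)
Definition submod_pred : {pred V} := I.
HB.instance Definition _ :=
  GRing.isSubmodClosed.Build R V submod_pred (submodClosedP I).

Definition submod_zmod : zmodClosed V := [the zmodClosed V of submod_pred].
Local Notation Q := (Quotient.quot submod_zmod).

Definition quot_scale (a : R) (x : Q) : Q := \pi_Q (a *: repr x).

Lemma quot_scale_pi a v : quot_scale a (\pi_Q v) = \pi_Q (a *: v).
Proof.
apply/eqP; rewrite /quot_scale -(@Quotient.idealrBE V submod_zmod) -scalerBr rpredZ //.
by rewrite (@Quotient.idealrBE V submod_zmod) reprK.
Qed.

Lemma quot_scaleA a b x : quot_scale a (quot_scale b x) = quot_scale (a * b) x.
Proof. rewrite -[x]reprK; rewrite (quot_scale_pi b) (quot_scale_pi a) (quot_scale_pi (a * b)).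
by rewrite scalerA. Qed.
Lemma quot_scale1 x : quot_scale 1 x = x.
Proof. by rewrite -[x]reprK quot_scale_pi scale1r. Qed.
Lemma quot_scaleDr a : {morph quot_scale a : x y / x + y}.
Proof.
move=> x y; rewrite -[x]reprK -[y]reprK.
rewrite -raddfD !(quot_scale_pi a) -raddfD.
by rewrite -scalerDr.
Qed.
Lemma quot_scaleDl x : {morph quot_scale^~ x : a b / a + b}.
Proof.
by move=> a b; rewrite -[x]reprK !quot_scale_pi -raddfD scalerDl.
Qed.

HB.instance Definition _ := GRing.Zmodule_isLmodule.Build R (Q)
  quot_scaleA quot_scale1 quot_scaleDr quot_scaleDl.

Definition lquot : lmodType R := Q.

Definition quot_pi (v : V) : lquot := \pi_Q v.

Lemma quot_pi_is_linear : linear quot_pi.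
Proof. by move=> a u v; rewrite /quot_pi raddfD /= -quot_scale_pi. Qed.
HB.instance Definition _ :=
  GRing.isLinear.Build R V (Q) *:%R quot_pi quot_pi_is_linear.

Lemma quot_pi_surj (x : lquot) : exists v, quot_pi v = x.
Proof. by exists (repr (x : Q)); rewrite /quot_pi reprK. Qed.

Lemma quot_pi_eq0 v : v \in I -> quot_pi v = 0.
Proof.
move=> vI; rewrite -(linear0 quot_pi); apply/eqP.
by rewrite /quot_pi -(@Quotient.idealrBE V submod_zmod) subr0.
Qed.

Section Lift.
Variables (W : lmodType R) (g : {linear V -> W}).
Hypothesis g0 : forall v, v \in I -> g v = 0.

Definition quot_lift_fun (x : lquot) : W := g (repr x).

Lemma quot_lift_pi v : quot_lift_fun (quot_pi v) = g v.
Proof.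
apply/eqP; rewrite -subr_eq0 -linearB; apply/eqP/g0.
by rewrite (@Quotient.idealrBE V submod_zmod) reprK.
Qed.

Lemma quot_lift_is_linear : linear quot_lift_fun.
Proof.
move=> a x y; rewrite -[x]reprK -[y]reprK.
by rewrite -![\pi_Q _]/(quot_pi _) -linearP !quot_lift_pi linearP.
Qed.
HB.instance Definition _ :=
  GRing.isLinear.Build R (Q) W *:%R quot_lift_fun quot_lift_is_linear.

Definition quot_lift : {linear lquot -> W} := quot_lift_fun.

End Lift.
End QuotientModule.

Definition coker (R : nzRingType) (U V : lmodType R) (f : {linear U -> V}) :
  lmodType R := lquot (lin_img f).

(* -------------------------------------------------------------------- *)
Section FreeModuleLift.
Variables (R : nzRingType) (K : choiceType) (M : lmodType R) (f : K -> M).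

Definition fmlift_fun : {freeg K / R} -> M := fglift f.

Lemma fmlift_is_linear : linear fmlift_fun.
Proof.
have fB D E : fmlift_fun (D - E) = fmlift_fun D - fmlift_fun E.
  exact: (lift_is_additive f).
have f0 : fmlift_fun 0 = 0 by rewrite -(subrr 0) fB subrr.
have fN D : fmlift_fun (- D) = - fmlift_fun D by rewrite -sub0r fB f0 sub0r.
have fD D E : fmlift_fun (D + E) = fmlift_fun D + fmlift_fun E.
  by rewrite -{1}(opprK E) fB fN opprK.
move=> a D E; rewrite fD; congr (_ + _).
rewrite -{2}(freeg_sumE D) [a *: D]/(fgscale a D) /fgscale.
elim: (dom D) => [|x s IH]; first by rewrite !big_nil !f0 scaler0.
by rewrite !big_cons !fD scalerDr IH /fmlift_fun !liftU scalerA.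
Qed.
HB.instance Definition _ :=
  GRing.isLinear.Build R {freeg K / R} M *:%R fmlift_fun fmlift_is_linear.

Definition fmlift : {linear {freeg K / R} -> M} := fmlift_fun.

Lemma fmliftU k : fmlift << k >> = f k.
Proof. by rewrite /= /fmlift_fun liftU scale1r. Qed.

End FreeModuleLift.

Lemma fmlift_uniq (R : nzRingType) (K : choiceType) (M : lmodType R)
  (f g : {linear {freeg K / R} -> M}) :
  (forall k, f << k >> = g << k >>) -> f =1 g.
Proof.
move=> fg D; rewrite -(freeg_sumE D) !linear_sum; apply: eq_bigr => x _.
have -> : << coeff x D *g x >> = coeff x D *: << x >> :> {freeg K / R}.
  by apply/eqP/freeg_eqP => y; rewrite coeffZ !coeffU mul1r.
by rewrite !linearZ /= fg.
Qed.

Section Tensor.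
Variables (R : comNzRingType).

Inductive bilinear_rel (M N : lmodType R) : {freeg (M * N)%type / R} -> Prop :=
| bil_addl m m' n : bilinear_rel (<< (m + m', n) >> - << (m, n) >> - << (m', n) >>)
| bil_addr m n n' : bilinear_rel (<< (m, n + n') >> - << (m, n) >> - << (m, n') >>)
| bil_scalel a m n : bilinear_rel (<< (a *: m, n) >> - a *: << (m, n) >>)
| bil_scaler a m n : bilinear_rel (<< (m, a *: n) >> - a *: << (m, n) >>).

Definition tensor (M N : lmodType R) : lmodType R := lquot (lspan (@bilinear_rel M N)).

Definition tens (M N : lmodType R) (m : M) (n : N) : tensor M N :=
  quot_pi (lspan (@bilinear_rel M N)) << (m, n) >>.

Section Map.
Variables (M N N' : lmodType R) (f : {linear N -> N'}).

Definition tensor_premap : {linear {freeg (M * N)%type / R} -> tensor M N'} :=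
  fmlift (fun p => tens p.1 (f p.2)).

Lemma tensor_premap0 v :
  v \in lspan (@bilinear_rel M N) -> tensor_premap v = 0.
Proof.
have kerP : submod_closed (fun v => tensor_premap v == 0).
  split=> [|a x y]; first by rewrite unfold_in linear0.
  by rewrite !unfold_in linearP => /eqP-> /eqP->; rewrite scaler0 addr0.
pose K : submodClosed _ := HB.pack (fun v => tensor_premap v == 0)
  (GRing.isSubmodClosed.Build R _ _ kerP).
move=> /asboolP/(_ K) h; apply/eqP/h => {v h} s hs.
rewrite unfold_in /=; apply/eqP.
have z t : @bilinear_rel M N' t -> quot_pi (lspan (@bilinear_rel M N')) t = 0.
  by move=> ht; apply: quot_pi_eq0; apply: mem_lspan.
have F p : tensor_premap << p >> = tens p.1 (f p.2) by exact: fmliftU.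
case: hs => [m m' n|m n n'|c m n|c m n]; rewrite ?linearB ?linearZ /= !F /=.
- by rewrite -(z _ (bil_addl m m' (f n))) !linearB.
- by rewrite linearD -(z _ (bil_addr m (f n) (f n'))) !linearB.
- by rewrite -(z _ (bil_scalel c m (f n))) linearB [in RHS]linearZ scalerN.
- by rewrite [f (c *: n)]linearZ -(z _ (bil_scaler c m (f n))) linearB [in RHS]linearZ scalerN.
Qed.

Definition tensor_map : {linear tensor M N -> tensor M N'} :=
  quot_lift tensor_premap0.

Lemma tensor_mapE m n : tensor_map (tens m n) = tens m (f n).
Proof. exact: etrans (quot_lift_pi tensor_premap0 _) (fmliftU _ _). Qed.

End Map.

Lemma tensor_ind_eq (M N W : lmodType R) (f g : {linear tensor M N -> W}) :
  (forall m n, f (tens m n) = g (tens m n)) -> f =1 g.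
Proof.
move=> fg x.
have [v <-] := quot_pi_surj x; move: v.
by apply: (@fmlift_uniq _ _ _ (f \o quot_pi _) (g \o quot_pi _)) => -[m n]; exact: fg.
Qed.

End Tensor.

(* -------------------------------------------------------------------- *)
Section ModulesOverR.
Variable R : comNzRingType.

Definition lmod_isom (M N : lmodType R) : Prop :=
  exists f : {linear M -> N}, bijective f.

Definition short_exact (A B C : lmodType R)
  (i : {linear A -> B}) (p : {linear B -> C}) : Prop :=
  [/\ injective i,
      forall b, p b = 0 <-> exists a, i a = b
    & forall c, exists b, p b = c].

Definition lmod_fgfree (M : lmodType R) : Prop :=
  exists n : nat, lmod_isom M 'rV[R]_n.

Definition lmod_fgproj (M : lmodType R) : Prop :=
  exists N : lmodType R, lmod_fgfree (M * N)%type.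

Record fgprojMod := FgprojMod {
  fgpm_mod :> lmodType R;
  fgpm_prop : lmod_fgproj fgpm_mod
}.

Definition K0 : abGroup :=
  @grothGroup fgprojMod (fun P Q => lmod_isom P Q)
    (fun A B C => exists (i : {linear A -> B}) (p : {linear B -> C}),
       short_exact i p).

Definition K0cls (P : fgprojMod) : K0 := pgen _ P.

(* The submodules of R^o are the ideals of R. *)
Definition is_pid : Prop :=
  GRing.integral_domain_axiom R /\
  forall I : submodClosed R^o,
    exists a : R, forall x : R, x \in I <-> exists b : R, x = b * a.

End ModulesOverR.

(* -------------------------------------------------------------------- *)
Record category := Category {
  ob :> Type;
  mor : ob -> ob -> choiceType;
  idm : forall x, mor x x;
  mcomp : forall x y z, mor y z -> mor x y -> mor x z;
  comp1m : forall x y (u : mor x y), mcomp (idm y) u = u;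
  compm1 : forall x y (u : mor x y), mcomp u (idm x) = u;
  compmA : forall x y z t (u : mor x y) (v : mor y z) (w : mor z t),
    mcomp w (mcomp v u) = mcomp (mcomp w v) u
}.
Arguments mor {c} x y : rename.
Arguments idm {c} x : rename.
Arguments mcomp {c x y z} v u : rename.

Section CategoryTheory.
Variable C : category.

Definition is_iso (x y : C) (u : mor x y) : Prop :=
  exists v : mor y x, mcomp v u = idm x /\ mcomp u v = idm y.

Definition ob_isom (x y : C) : Prop := exists u : mor x y, is_iso u.

Definition Ugroup : abGroup := freeAb (eqclass ob_isom).

Definition Ucls (x : C) : Ugroup := pgen _ (eqclass_of ob_isom x).

End CategoryTheory.

Section ModulesOverCategory.
Variables (R : comNzRingType) (C : category).

Record rcMod := RCMod {
  rc_val :> C -> lmodType R;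
  rc_act : forall x y, mor x y -> {linear rc_val y -> rc_val x};
  rc_act1 : forall x m, rc_act (idm x) m = m;
  rc_actM : forall x y z (u : mor x y) (v : mor y z) m,
    rc_act (mcomp v u) m = rc_act u (rc_act v m)
}.

Record rcHom (M N : rcMod) := RCHom {
  rc_comp :> forall x, {linear M x -> N x};
  rc_nat : forall x y (u : mor x y) m,
    rc_comp x (rc_act M u m) = rc_act N u (rc_comp y m)
}.

Definition rc_isom (M N : rcMod) : Prop :=
  exists f : rcHom M N, forall x, bijective (f x).

Definition rc_ses (L M N : rcMod) : Prop :=
  exists (i : rcHom L M) (p : rcHom M N), forall x, short_exact (i x) (p x).

Definition rc_zero : rcMod :=
  @RCMod (fun=> 'rV[R]_0) (fun _ _ _ => idfun)
    (fun _ _ => erefl) (fun _ _ _ _ _ _ => erefl).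

Section PairMap.
Variables (A B A' B' : lmodType R) (f : {linear A -> A'}) (g : {linear B -> B'}).
Definition pair_map (m : A * B) : A' * B' := (f m.1, g m.2).
Lemma pair_map_is_linear : linear pair_map.
Proof. by move=> a m n; rewrite /pair_map !linearP. Qed.
HB.instance Definition _ :=
  GRing.isLinear.Build R (A * B)%type (A' * B')%type *:%R pair_map
    pair_map_is_linear.
End PairMap.

Section DirectSum.
Variables M N : rcMod.

Definition rc_dsum_act x y (u : mor x y) :
  {linear (M y * N y)%type -> (M x * N x)%type} :=
  pair_map (rc_act M u) (rc_act N u).

Lemma rc_dsum_act1 x m : rc_dsum_act (idm x) m = m.
Proof. by case: m => m n; rewrite /= /pair_map !rc_act1. Qed.
Lemma rc_dsum_actM x y z (u : mor x y) (v : mor y z) m :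
  rc_dsum_act (mcomp v u) m = rc_dsum_act u (rc_dsum_act v m).
Proof. by rewrite /= /pair_map !rc_actM. Qed.

Definition rc_dsum : rcMod := RCMod rc_dsum_act1 rc_dsum_actM.

End DirectSum.

Definition rc_bigsum (s : seq rcMod) : rcMod := foldr rc_dsum rc_zero s.

Section Representable.
Variable x : C.

Definition Rmor_val (y : C) : lmodType R := {freeg (mor y x) / R}.
Definition Rmor_act y z (u : mor y z) : {linear Rmor_val z -> Rmor_val y} :=
  fmlift (fun p : mor z x => << mcomp p u >> : Rmor_val y).

Lemma Rmor_act1 y m : Rmor_act (idm y) m = m.
Proof.
apply: (@fmlift_uniq _ _ _ (Rmor_act (idm y)) idfun) => k.
by rewrite fmliftU compm1.
Qed.
Lemma Rmor_actM y z t (u : mor y z) (v : mor z t) m :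
  Rmor_act (mcomp v u) m = Rmor_act u (Rmor_act v m).
Proof.
apply: (@fmlift_uniq _ _ _ (Rmor_act (mcomp v u)) (Rmor_act u \o Rmor_act v)) => k.
by rewrite [RHS]/= !fmliftU compmA.
Qed.

Definition Rmor : rcMod := RCMod Rmor_act1 Rmor_actM.

End Representable.

Definition rc_fgfree (M : rcMod) : Prop :=
  exists s : seq C, rc_isom M (rc_bigsum [seq Rmor x | x <- s]).

Definition rc_fgproj (M : rcMod) : Prop :=
  exists N : rcMod, rc_fgfree (rc_dsum M N).

Record fgprojRC := FgprojRC {
  fgprc_mod :> rcMod;
  fgprc_prop : rc_fgproj fgprc_mod
}.

Record fgfreeRC := FgfreeRC {
  fgfrc_mod :> rcMod;
  fgfrc_prop : rc_fgfree fgfrc_mod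
}.

Definition K0rc : abGroup :=
  @grothGroup fgprojRC (fun P Q => rc_isom P Q) (fun A B C => rc_ses A B C).

Definition K0rc_cls (P : fgprojRC) : K0rc := pgen _ P.

Definition K0f : abGroup :=
  @grothGroup fgfreeRC (fun P Q => rc_isom P Q) (fun A B C => rc_ses A B C).

Definition K0f_cls (P : fgfreeRC) : K0f := pgen _ P.

Section TensorRC.
Variables (Q : lmodType R) (M : rcMod).

Definition tensorRC_act x y (u : mor x y) :
  {linear tensor Q (M y) -> tensor Q (M x)} :=
  tensor_map Q (rc_act M u).

Lemma tensorRC_act1 x m : tensorRC_act (idm x) m = m.
Proof.
apply: (@tensor_ind_eq _ _ _ _ (tensorRC_act (idm x)) idfun) => q n.
by rewrite tensor_mapE rc_act1.
Qed.
Lemma tensorRC_actM x y z (u : mor x y) (v : mor y z) m :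
  tensorRC_act (mcomp v u) m = tensorRC_act u (tensorRC_act v m).
Proof.
apply: (@tensor_ind_eq _ _ _ _ (tensorRC_act (mcomp v u)) (tensorRC_act u \o tensorRC_act v)) => q n.
rewrite [RHS](congr1 (tensorRC_act u) (tensor_mapE (rc_act M v) q n)).
by rewrite !tensor_mapE rc_actM.
Qed.

Definition tensorRC : rcMod := RCMod tensorRC_act1 tensorRC_actM.

End TensorRC.

Definition extE (x : C) (Q : lmodType R) : rcMod := tensorRC Q (Rmor x).

Definition splitS (x : C) (P : rcMod) : lmodType R :=
  lquot (lspan (fun m : P x =>
    exists (y : C) (u : mor x y) (n : P y), ~ is_iso u /\ m = rc_act P u n)).

End ModulesOverCategory.

(* -------------------------------------------------------------------- *)
Inductive obA : Type := a1 | a2 | a3 | a4.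

Inductive morA : obA -> obA -> Type :=
| id1 : morA a1 a1 | f11 : morA a1 a1
| f12 : morA a1 a2 | g12 : morA a1 a2
| f13 : morA a1 a3
| f14 : morA a1 a4
| f21 : morA a2 a1 | g21 : morA a2 a1
| id2 : morA a2 a2 | f22 : morA a2 a2
| f23 : morA a2 a3
| f24 : morA a2 a4 | g24 : morA a2 a4
| f31 : morA a3 a1
| f32 : morA a3 a2
| f33 : morA a3 a3
| f34 : morA a3 a4
| f44 : morA a4 a4.

HB.instance Definition _ (x y : obA) := gen_eqMixin (morA x y).
HB.instance Definition _ (x y : obA) := gen_choiceMixin (morA x y).

Definition idA (x : obA) : morA x x :=
  match x with a1 => id1 | a2 => id2 | a3 => f33 | a4 => f44 end.

Definition fA1 (k : obA) : morA a1 k :=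
  match k with a1 => f11 | a2 => f12 | a3 => f13 | a4 => f14 end.
Definition fA2 (k : obA) : morA a2 k :=
  match k with a1 => f21 | a2 => f22 | a3 => f23 | a4 => f24 end.
Definition fA3 (k : obA) : morA a3 k :=
  match k with a1 => f31 | a2 => f32 | a3 => f33 | a4 => f34 end.

(* An f-arrow p out of a_i composes with every q to some f_ik, including   *)
(* when q is an identity; only the identities and the g-arrows need care. *)
Definition compA (x y z : obA) (q : morA y z) (p : morA x y) : morA x z :=
  match p in morA x y return morA y z -> morA x z with
  | id1 | id2 | f33 | f44 => fun q => q
  | f11 | f12 | f13 | f14 => fun _ => fA1 z
  | f21 | f22 | f23 | f24 => fun _ => fA2 z
  | f31 | f32 | f34 => fun _ => fA3 z
  | g12 => fun q => match q in morA y z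
             return match y return Type with a2 => morA a1 z | _ => unit end with
             | id2 => g12
             | f21 => f11 | g21 => f11 | f22 => f12 | f23 => f13
             | f24 => f14 | g24 => f14
             | _ => tt
             end
  | g21 => fun q => match q in morA y z
             return match y return Type with a1 => morA a2 z | _ => unit end with
             | id1 => g21
             | f11 => f21 | f12 => f22 | g12 => f22 | f13 => f23 | f14 => f24
             | _ => tt
             end
  | g24 => fun q => match q in morA y z
             return match y return Type with a4 => morA a2 z | _ => unit end with
             | f44 => g24
             | _ => tt
             end
  end q.

Definition is_idA (x y : obA) (u : morA x y) : bool :=
  match u with id1 | id2 | f33 | f44 => true | _ => false end.

Definition fA (i k : obA) : option (morA i k) :=
  match i, k with
  | a1, k => Some (fA1 k)
  | a2, k => Some (fA2 k)
  | a3, k => Some (fA3 k)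
  | a4, a4 => Some f44
  | a4, _ => None
  end.

Definition morA_from1 (P : forall z, morA a1 z -> Prop) (hid : P a1 id1)
  (hg : P a2 g12) (hf : forall z, P z (fA1 z)) z (v : morA a1 z) : P z v :=
  match v with
  | id1 => hid | g12 => hg
  | f11 => hf a1 | f12 => hf a2 | f13 => hf a3 | f14 => hf a4
  end.

Definition morA_from2 (P : forall z, morA a2 z -> Prop) (hid : P a2 id2)
  (hg1 : P a1 g21) (hg4 : P a4 g24) (hf : forall z, P z (fA2 z))
  z (v : morA a2 z) : P z v :=
  match v with
  | id2 => hid | g21 => hg1 | g24 => hg4
  | f21 => hf a1 | f22 => hf a2 | f23 => hf a3 | f24 => hf a4
  end.

Definition morA_from3 (P : forall z, morA a3 z -> Prop)
  (hf : forall z, P z (fA3 z)) z (v : morA a3 z) : P z v :=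
  match v with
  | f31 => hf a1 | f32 => hf a2 | f33 => hf a3 | f34 => hf a4
  end.

Definition morA_from4 (P : forall z, morA a4 z -> Prop) (hid : P a4 f44)
  z (v : morA a4 z) : P z v :=
  match v with f44 => hid end.

Local Ltac case_morA v := move: v;
  lazymatch goal with
  | |- forall v : morA a1 ?z, _ => move: z; apply: morA_from1 => [||[]]
  | |- forall v : morA a2 ?z, _ => move: z; apply: morA_from2 => [|||[]]
  | |- forall v : morA a3 ?z, _ => move: z; apply: morA_from3 => -[]
  | |- forall v : morA a4 ?z, _ => move: z; apply: morA_from4
  end.

Lemma compA1m x y (u : morA x y) : compA (idA y) u = u.
Proof. by case: x y / u. Qed.

Lemma compAm1 x y (u : morA x y) : compA u (idA x) = u.
Proof. by case: x u. Qed.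

Lemma compAA x y z t (u : morA x y) (v : morA y z) (w : morA z t) :
  compA w (compA v u) = compA (compA w v) u.
Proof.
case: x y / u v => v; move: t w; case_morA v => t w; by [|case_morA w].
Qed.

(* q o p = f_ik for non-identity p : a_i -> a_j and q : a_j -> a_k.        *)
Lemma compA_f x y z (p : morA x y) (q : morA y z) :
  ~~ is_idA p -> ~~ is_idA q -> Some (compA q p) = fA x z.
Proof. by case: x y / p q => q; case_morA q. Qed.

Definition AAcat : category := Category compA1m compAm1 compAA.

Section ModulesK.
Variables (R : comNzRingType) (Q : lmodType R).

Definition Kval (x : obA) : lmodType R :=
  match x with a1 | a2 => Q | a3 | a4 => 'rV[R]_0 end.

Definition lid : {linear Q -> Q} := idfun.
Definition lzero (M N : lmodType R) : {linear M -> N} := \0.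

Definition Kact (first : bool) (x y : obA) (u : morA x y) :
  {linear Kval y -> Kval x} :=
  match u in morA x y return {linear Kval y -> Kval x} with
  | id1 | id2 => lid
  | g21 => if first then lid else lzero Q Q
  | g12 => if first then lzero Q Q else lid
  | f11 | f12 | f21 | f22 => lzero Q Q
  | _ => lzero _ _
  end.

Lemma Kact1 first x m : Kact first (idA x) m = m.
Proof. by case: x m => m //=; rewrite [RHS]thinmx0 [LHS]thinmx0. Qed.

Lemma KactM first x y z (u : morA x y) (v : morA y z) m :
  Kact first (compA v u) m = Kact first u (Kact first v m).
Proof.
case: x y / u v m => v; case_morA v => m; by case: first; rewrite /= ?linear0.
Qed.

Definition Kmod (first : bool) : rcMod R AAcat :=
  @RCMod R AAcat Kval (Kact first) (Kact1 first) (KactM first).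

Definition K1 : rcMod R AAcat := Kmod true.
Definition K2 : rcMod R AAcat := Kmod false.

End ModulesK.

(* Main.v *)
From HB Require Import structures.
From mathcomp Require Import all_boot all_algebra.
From mathcomp Require Import boolp.
From mathcomp.multinomials Require Import freeg.
Require Import Defs.

Set Implicit Arguments.
Unset Strict Implicit.
Unset Printing Implicit Defensive.

Import GRing.Theory.
Local Open Scope ring_scope.

(** In the linearization of the category, a3 is a direct summand of a1 and of
    a2, as f13 o f31 = f33 = f23 o f32. Splitting off the idempotents f11 and
    f22 leaves objects b1 and b2, and the category becomes the quiver with
    arrows g12 - f12 : b1 -> b2, g21 - f21 : b2 -> b1, g24 - f24 : b2 -> a4
    and f34 : a3 -> a4, in which every composite of two arrows is zero. The
    projective modules represented by b1, b2, a3, a4 are K_1(R), K_2(R),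
    E_a3(R), E_a4(R) (below: [std j R^o]), and S_a1, S_a2, the cokernel of f34
    and S_a4 (below: [head j]) are the quotients of the values at b1, b2, a3
    and a4 by the radical, the submodule generated by the images of the four
    arrows.

    Since composites vanish, two maps with image in the radical compose to
    zero ([rad_square_zero]), so maps that are mutually inverse on all heads
    are isomorphisms ([head_inverse_isom]). Representable modules, hence all
    finitely generated projective ones, are retracts of sums of standard
    modules, and comparing heads turns such a retraction into an isomorphism
    of M with the sum over j of the standard modules on the heads of M
    ([std_decomposition]). As the i-th head of [std j Q] is Q for i = j and 0
    otherwise ([head_std_diag], [head_std_off]), xi and eta are inverse. Both
    are well defined because short exact sequences of projective modules
    split and additive functors preserve split sequences.

    For the second part, R mor(?,a1) and R mor(?,a2) are extensions of
    R mor(?,a3) by K_1(R) and K_2(R) ([Rmor1_split], [Rmor2_split]). So the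
    heads of a free module are free, and their ranks are a unitriangular
    function of the multiplicities of the representable modules; inverting it
    inverts iota ([rank_class_Rmor]). Over a principal ideal domain the heads
    of projective modules are free too ([pid_fgproj_free]), so that the same
    rank formula is defined on all of K_0(RA) and makes the forgetful map
    injective; it is surjective since K_0(R) is generated by [R] and
    [K_i(R)] = [R mor(?,a_i)] - [R mor(?,a3)] for i = 1, 2. *)

(** * Abelian groups given by generators and relations *)

Section AbGroupTheory.
Variable G : abGroup.
Implicit Types x y z : G.
Local Open Scope ag_scope.

Lemma agD0 x : x + ag0 = x.
Proof. by rewrite agDC ag0D. Qed.

Lemma agDN x : x + agN x = ag0.
Proof. by rewrite agDC agND. Qed.

Lemma agDI x y z : x + y = x + z -> y = z.
Proof. by move=> h; rewrite -[y]ag0D -[z]ag0D -(agND x) -!agDA h. Qed.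

Lemma agDACA x y z t : (x + y) + (z + t) = (x + z) + (y + t).
Proof. by rewrite -agDA (agDA y) (agDC y) -agDA agDA. Qed.

Lemma idem_ag0 x : x = x + x -> x = ag0.
Proof. by move=> e; apply: (@agDI x); rewrite agD0 -e. Qed.

Lemma agN_uniq x y : x + y = ag0 -> y = agN x.
Proof. by move=> h; apply: (@agDI x); rewrite h agDN. Qed.

Definition ag_muln x n : G := iter n (agD x) ag0.

Lemma ag_mulnD x m n : ag_muln x (m + n)%N = ag_muln x m + ag_muln x n.
Proof. by elim: m => [|m IH] /=; rewrite ?ag0D // IH agDA. Qed.

Definition ag_sum4 (w : obA -> G) : G := w a1 + w a2 + w a3 + w a4.

Lemma ag_sum4D (v w : obA -> G) :
  ag_sum4 (fun i => v i + w i) = ag_sum4 v + ag_sum4 w.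
Proof.
rewrite /ag_sum4 [RHS]agDACA; congr agD; rewrite [RHS]agDACA; congr agD.
exact: agDACA.
Qed.

End AbGroupTheory.

Lemma eqclass_surj (T : Type) (e : T -> T -> Prop) (c : eqclass e) :
  exists x, c = eqclass_of e x.
Proof.
case: c => c hc; have [x cx] := hc; exists x; subst c.
by rewrite /eqclass_of; congr exist; apply: Prop_irrelevance.
Qed.

Section Homomorphisms.
Local Open Scope ag_scope.

Section Basics.
Variables (G H : abGroup) (f : G -> H) (hf : ag_hom f).

Lemma ag_hom0 : f ag0 = ag0.
Proof. by apply: (@agDI _ (f ag0)); rewrite -hf ag0D agD0. Qed.

Lemma ag_homN x : f (agN x) = agN (f x).
Proof. by apply: agN_uniq; rewrite -hf agDN ag_hom0. Qed.

Lemma ag_hom_muln x n : f (ag_muln x n) = ag_muln (f x) n.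
Proof. by elim: n => [|n IH] /=; rewrite ?ag_hom0 // hf IH. Qed.

Lemma ag_hom_sum4 w : f (ag_sum4 w) = ag_sum4 (fun i => f (w i)).
Proof. by rewrite /ag_sum4 !hf. Qed.

End Basics.

Lemma ag_hom_comp (G H K : abGroup) (f : G -> H) (g : H -> K) :
  ag_hom f -> ag_hom g -> ag_hom (g \o f).
Proof. by move=> hf hg x y; rewrite /= hf hg. Qed.

Variables (T : Type) (r : gexp T -> gexp T -> Prop).

Lemma pres_ind (P : presGroup r -> Prop) :
  P ag0 -> (forall t, P (pgen r t)) ->
  (forall x y, P x -> P y -> P (x + y)) -> (forall x, P x -> P (agN x)) ->
  forall x, P x.
Proof.
move=> P0 Pg PD PN x; rewrite -(pg_reprK x).
elim: (pg_repr x) => [|t|u IHu v IHv|u IHu] //.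
- exact: Pg.
- by have := PD _ _ IHu IHv; rewrite /= pg_DE.
- by have := PN _ IHu; rewrite /= pg_NE.
Qed.

Lemma pres_hom_ext (G : abGroup) (f g : presGroup r -> G) :
  ag_hom f -> ag_hom g -> (forall t, f (pgen r t) = g (pgen r t)) -> f =1 g.
Proof.
move=> hf hg fg; apply: pres_ind => [|t|x y ex ey|x ex] //.
- by rewrite !ag_hom0.
- by rewrite hf hg ex ey.
- by rewrite !ag_homN // ex.
Qed.

Variables (G : abGroup) (phi : T -> G).

Fixpoint gexp_eval (e : gexp T) : G :=
  match e with
  | Gzero => ag0
  | Ggen t => phi t
  | Gadd x y => gexp_eval x + gexp_eval y
  | Gopp x => agN (gexp_eval x)
  end.

Definition pres_lift (x : presGroup r) : G := gexp_eval (pg_repr x).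

Hypothesis phi_r : forall x y, r x y -> gexp_eval x = gexp_eval y.

Lemma pres_liftE e : pres_lift (eqclass_of (gexp_eq r) e) = gexp_eval e.
Proof.
have eval_eq x y : gexp_eq r x y -> gexp_eval x = gexp_eval y.
  elim=> //= {x y}.
  - by move=> x y z _ -> _ ->.
  - by move=> x x' y y' _ -> _ ->.
  - by move=> x x' _ ->.
  - by move=> x y z; rewrite agDA.
  - by move=> x y; rewrite agDC.
  - by move=> x; rewrite ag0D.
  - by move=> x; rewrite agND.
exact/eval_eq/pg_repr_cls.
Qed.

Lemma pres_lift_gen t : pres_lift (pgen r t) = phi t.
Proof. exact: pres_liftE. Qed.

Lemma pres_lift_hom : ag_hom pres_lift.
Proof.
move=> x y; rewrite -[x]pg_reprK -[y]pg_reprK.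
by rewrite [(_ + _)]pg_DE !pres_liftE.
Qed.

End Homomorphisms.

(** Surjectivity onto a presented group is reduced to its generators by the
    closure properties of an image. *)
Section HomImages.
Local Open Scope ag_scope.
Variables (G H : abGroup) (f : G -> H) (hf : ag_hom f).

Definition hom_img (y : H) : Prop := exists x, f x = y.

Lemma hom_img0 : hom_img ag0.
Proof. by exists ag0; apply: ag_hom0. Qed.
Lemma hom_imgD y z : hom_img y -> hom_img z -> hom_img (y + z).
Proof. by move=> [a <-] [b <-]; exists (a + b). Qed.
Lemma hom_imgN y : hom_img y -> hom_img (agN y).
Proof. by move=> [a <-]; exists (agN a); apply: ag_homN. Qed.
Lemma hom_img_muln y n : hom_img y -> hom_img (ag_muln y n).
Proof. by move=> [a <-]; exists (ag_muln a n); apply: ag_hom_muln. Qed.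
Lemma hom_img_pres (T : Type) (r : gexp T -> gexp T -> Prop) (e : presGroup r -> H) :
  ag_hom e -> (forall t, hom_img (e (pgen r t))) -> forall x, hom_img (e x).
Proof.
move=> he hgen; apply: pres_ind => [|//|x y|x].
- by rewrite ag_hom0 //; apply: hom_img0.
- by rewrite he; apply: hom_imgD.
- by rewrite ag_homN //; apply: hom_imgN.
Qed.

End HomImages.

Section GrothendieckGroups.
Variables (T : Type) (iso : T -> T -> Prop) (ses : T -> T -> T -> Prop).
Local Notation gen := (pgen (groth_rel iso ses)).
Local Open Scope ag_scope.

Lemma groth_gen_iso A B : iso A B -> gen A = gen B.
Proof. by move=> h; apply/pg_eq/Geq_rel/groth_iso. Qed.

Lemma groth_gen_ses A B C : ses A B C -> gen B = gen A + gen C.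
Proof.
move=> h.
transitivity (eqclass_of (gexp_eq (groth_rel iso ses)) (Gadd (Ggen A) (Ggen C))).
  exact/pg_eq/Geq_rel/groth_ses.
by rewrite /= pg_DE.
Qed.

Lemma groth_lift (G : abGroup) (phi : T -> G) :
  (forall A B, iso A B -> phi A = phi B) ->
  (forall A B C, ses A B C -> phi B = phi A + phi C) ->
  exists f : grothGroup iso ses -> G, ag_hom f /\ forall t, f (gen t) = phi t.
Proof.
move=> hiso hses.
have hr x y : groth_rel iso ses x y -> gexp_eval phi x = gexp_eval phi y.
  by case=> [A B /hiso|A B C /hses].
exists (@pres_lift T (groth_rel iso ses) G phi); split.
  exact: pres_lift_hom.
by move=> t; apply: pres_lift_gen.
Qed.

End GrothendieckGroups.

(** * Split extensions and free modules over a ring *)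

Section LinearConstructions.
Variable R : comNzRingType.

(** Packaging on the spot serves the many linear maps that are built inside a
    proof, from data obtained by choice. *)
Definition mkLin (U V : lmodType R) (f : U -> V) (hf : linear f) :
    {linear U -> V} := HB.pack f (GRing.isLinear.Build R U V *:%R f hf).

Lemma linear_pairing (U V W : lmodType R) (f : {linear U -> V}) (g : {linear U -> W}) :
  linear (fun x => (f x, g x) : (V * W)%type).
Proof. by move=> a x y; rewrite !linearP. Qed.

Lemma bij_linear_inv (U V : lmodType R) (f : {linear U -> V}) :
  bijective f -> exists g : {linear V -> U}, cancel f g /\ cancel g f.
Proof.
case=> g fg gf.
have lg : linear g.
  by move=> a x y; apply: (can_inj fg); rewrite linearP !gf.
by exists (mkLin lg).
Qed.

Lemma scale_linear (M : lmodType R) (m : M) : linear (fun r : R^o => r *: m).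
Proof. by move=> a x y; rewrite scalerDl scalerA. Qed.

Section ProductMaps.
Variables A C : lmodType R.

Lemma linl_linear : linear (fun a : A => (a, 0) : (A * C)%type).
Proof. by move=> a x y; congr pair; rewrite /= scaler0 addr0. Qed.
Lemma linr_linear : linear (fun c : C => (0, c) : (A * C)%type).
Proof. by move=> a x y; congr pair; rewrite /= scaler0 addr0. Qed.
Lemma lfst_linear : linear (fun x : (A * C)%type => x.1).
Proof. by []. Qed.
Lemma lsnd_linear : linear (fun x : (A * C)%type => x.2).
Proof. by []. Qed.

Definition linl := mkLin linl_linear.
Definition linr := mkLin linr_linear.
Definition lfst := mkLin lfst_linear.
Definition lsnd := mkLin lsnd_linear.

End ProductMaps.

(** A short exact sequence with a chosen splitting consists of equations
    between maps only, which is what an additive functor preserves. *)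
Definition lsplit (A B C : lmodType R) : Prop :=
  exists (i : {linear A -> B}) (p : {linear B -> C})
         (r : {linear B -> A}) (s : {linear C -> B}),
  [/\ cancel i r, cancel s p & forall b, i (r b) + s (p b) = b].

Lemma split_kernel (A B C : lmodType R) (i : {linear A -> B}) (p : {linear B -> C})
    (r : {linear B -> A}) (s : {linear C -> B}) :
  cancel i r -> cancel s p -> (forall b, i (r b) + s (p b) = b) ->
  short_exact i p.
Proof.
move=> ir sp e; split; first exact: can_inj ir.
  move=> b; split=> [pb0|[a <-]].
    by exists (r b); rewrite -[RHS]e pb0 linear0 addr0.
  have := congr1 p (e (i a)); rewrite ir linearD sp.
  by move/(congr1 (fun x => x - p (i a))); rewrite addrK subrr.
by move=> c; exists (s c).
Qed.

Lemma lsplit_ses (A B C : lmodType R) : lsplit A B C ->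
  exists (i : {linear A -> B}) (p : {linear B -> C}), short_exact i p.
Proof. by case=> i [p] [r] [s] [? ? ?]; exists i, p; apply: split_kernel. Qed.

(** Subtracting from b its part in the image of the section leaves an element
    of the kernel of p, so it comes from a unique element of A. *)
Lemma ses_lsplit (A B C : lmodType R) (i : {linear A -> B}) (p : {linear B -> C})
    (s : {linear C -> B}) :
  short_exact i p -> cancel s p ->
  exists r : {linear B -> A}, cancel i r /\ forall b, i (r b) + s (p b) = b.
Proof.
move=> [inj_i ker_p _] sp.
have ex b : exists a, i a = b - s (p b).
  by apply/ker_p; rewrite linearB sp subrr.
pose r b := sval (cid (ex b)).
have ir b : i (r b) = b - s (p b) by rewrite /r; case: cid.
have lr : linear r.
  move=> a x y; apply: inj_i; rewrite linearP !ir (linearP p) (linearP s).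
  by rewrite opprD addrACA scalerBr.
exists (mkLin lr); split=> [a|b] /=; last by rewrite ir subrK.
apply: inj_i; rewrite ir.
by have /ker_p-> : exists a', i a' = i a; [exists a | rewrite linear0 subr0].
Qed.

Lemma lmod_isom_refl (M : lmodType R) : lmod_isom M M.
Proof. by exists idfun; exists idfun. Qed.

Lemma lmod_isom_sym (M N : lmodType R) : lmod_isom M N -> lmod_isom N M.
Proof. by case=> f /bij_linear_inv[g [fg gf]]; exists g, f. Qed.

Lemma lmod_isom_trans (M N P : lmodType R) :
  lmod_isom M N -> lmod_isom N P -> lmod_isom M P.
Proof. by case=> f hf [g hg]; exists (g \o f); apply: bij_comp. Qed.

Lemma lmod_isom_prod (M M' N N' : lmodType R) :
  lmod_isom M M' -> lmod_isom N N' -> lmod_isom (M * N)%type (M' * N')%type.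
Proof.
case=> f [f' ff' f'f] [g [g' gg' g'g]]; exists (pair_map f g).
by exists (fun x => (f' x.1, g' x.2)) => -[m n] /=; rewrite /pair_map /= ?ff' ?gg' ?f'f ?g'g.
Qed.

Lemma lsplit_isom (A B C : lmodType R) :
  lsplit A B C -> lmod_isom B (A * C)%type.
Proof.
case=> i [p] [r] [s] [ir sp e].
have [_ ker _] := split_kernel ir sp e.
exists (mkLin (linear_pairing r p)), (fun x => i x.1 + s x.2) => [b|[a c]] //=.
have pi0 : p (i a) = 0 by apply/ker; exists a.
have rs0 : r (s c) = 0.
  by apply: (can_inj ir); apply: (addIr (s (p (s c)))); rewrite e linear0 add0r sp.
by rewrite !linearD ir sp pi0 rs0 addr0 add0r.
Qed.

Lemma isom_lsplit (A B C : lmodType R) :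
  lmod_isom B (A * C)%type -> lsplit A B C.
Proof.
case=> f /bij_linear_inv[g [fg gf]].
exists (g \o linl A C), (lsnd A C \o f), (lfst A C \o f), (g \o linr A C).
split=> [a|c|b] /=; rewrite ?gf //.
rewrite -linearD; have -> : ((f b).1, 0) + (0, (f b).2) = f b :> (A * C)%type.
  by case: (f b) => x y; congr pair; rewrite ?addr0 ?add0r.
by rewrite fg.
Qed.

Lemma lsplit_prod (A C : lmodType R) : lsplit A (A * C)%type C.
Proof. exact/isom_lsplit/lmod_isom_refl. Qed.

Lemma lmod_prodA (A B C : lmodType R) :
  lmod_isom (A * (B * C))%type ((A * B) * C)%type.
Proof.
have l : linear (fun x : (A * (B * C))%type =>
  ((x.1, x.2.1), x.2.2) : ((A * B) * C)%type) by [].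
by exists (mkLin l), (fun x => (x.1.1, (x.1.2, x.2))) => [[? [? ?]]|[[? ?] ?]].
Qed.

Lemma lmod_prodACA (A B C D : lmodType R) :
  lmod_isom ((A * B) * (C * D))%type ((A * C) * (B * D))%type.
Proof.
have l : linear (fun x : ((A * B) * (C * D))%type =>
  ((x.1.1, x.2.1), (x.1.2, x.2.2)) : ((A * C) * (B * D))%type) by [].
by exists (mkLin l), (fun x => ((x.1.1, x.2.1), (x.1.2, x.2.2))) => -[[? ?] []].
Qed.

(** The map sending v to v - i (r v) vanishes on the image of i, and so induces
    a section of the projection to the cokernel. *)
Lemma retract_summand (M N : lmodType R) (i : {linear M -> N}) (r : {linear N -> M}) :
  cancel i r -> lmod_isom N (M * coker i)%type.
Proof.
move=> ir.
have lg : linear (fun v => v - i (r v)).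
  by move=> a x y; rewrite (linearP r) (linearP i) opprD addrACA scalerBr.
have g0 v : v \in lin_img i -> mkLin lg v = 0.
  by move=> /asboolP[u <-] /=; rewrite ir subrr.
pose q : {linear N -> coker i} := quot_pi (lin_img i).
have gE v : quot_lift g0 (q v) = v - i (r v) := quot_lift_pi g0 v.
have q0 u : q (i u) = 0 by apply: quot_pi_eq0; apply/asboolP; exists u.
exists (mkLin (linear_pairing r q)), (fun x => i x.1 + quot_lift g0 x.2).
  by move=> v; rewrite [LHS](congr1 (+%R (i (r v))) (gE v)) addrC subrK.
case=> m c; have [v ->] : exists v, c = q v by have [v] := quot_pi_surj c; exists v.
have -> : i (m, q v).1 + quot_lift g0 (m, q v).2 = i m + (v - i (r v)) by rewrite gE.
change ((r (i m + (v - i (r v))), q (i m + (v - i (r v)))) = (m, q v)).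
rewrite (linearD r) (linearB r) (linearD q) (linearB q) !ir !q0.
by rewrite subrr addr0 subr0 add0r.
Qed.

Lemma quot_pi_ker (V : lmodType R) (I : submodClosed V) v :
  quot_pi I v = 0 -> v \in I.
Proof.
move=> /eqP; rewrite -(linear0 (quot_pi I)) /quot_pi.
by rewrite -(@Quotient.idealrBE V (submod_zmod I)) subr0.
Qed.

Lemma fgfree_isom (M N : lmodType R) :
  lmod_isom M N -> lmod_fgfree N -> lmod_fgfree M.
Proof. by move=> h [n hn]; exists n; apply: lmod_isom_trans hn. Qed.

Lemma rV_prod m n : lmod_isom ('rV[R]_m * 'rV[R]_n)%type 'rV[R]_(m + n).
Proof.
have l : linear (fun x : ('rV[R]_m * 'rV[R]_n)%type => row_mx x.1 x.2).
  by move=> a x y; rewrite /= -add_row_mx -scale_row_mx.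
exists (mkLin l), (fun v => (lsubmx v, rsubmx v)) => [[u v]|v] /=.
  by rewrite row_mxKl row_mxKr.
by rewrite hsubmxK.
Qed.

Lemma Ro_rV1 : lmod_isom R^o 'rV[R]_1.
Proof.
have l : linear (fun x : R^o => const_mx (x : R) : 'rV[R]_1).
  by move=> a x y; apply/rowP => i; rewrite !mxE.
exists (mkLin l), (fun v : 'rV[R]_1 => v 0 0 : R^o) => [x|v] /=; first by rewrite mxE.
by apply/rowP => i; rewrite mxE ord1.
Qed.

(** Over a nonzero commutative ring a matrix with a right inverse has at most
    as many rows as columns, by a determinant argument. *)
Lemma rV_isom_dim m n : lmod_isom 'rV[R]_m 'rV[R]_n -> m = n.
Proof.
have le k l : lmod_isom 'rV[R]_k 'rV[R]_l -> (k <= l)%N.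
  case=> f /bij_linear_inv[g [fg gf]].
  apply: (@mulmx1_min R k l (lin1_mx f) (lin1_mx g)).
  by apply/row_matrixP => i; rewrite row_mul !rowE mulmx1 !mul_rV_lin1 fg.
move=> h; apply/eqP; rewrite eqn_leq (le _ _ h) /=.
exact/le/lmod_isom_sym.
Qed.

(** Total, with the junk value 0 on modules that are not free, so that it can
    be summed over heads before these are known to be free. *)
Definition lrank (M : lmodType R) : nat :=
  if pselect (lmod_fgfree M) is left h then sval (cid h) else 0%N.

Lemma lrankE (M : lmodType R) n : lmod_isom M 'rV[R]_n -> lrank M = n.
Proof.
move=> h; rewrite /lrank; case: pselect => [h'|[]]; last by exists n.
case: cid => m /= hm; apply: rV_isom_dim.
by apply: lmod_isom_trans h; apply: lmod_isom_sym.
Qed.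

Lemma lrank_isom (M N : lmodType R) :
  lmod_fgfree N -> lmod_isom M N -> lrank M = lrank N.
Proof.
by case=> n hn h; rewrite (lrankE hn); apply/lrankE/(lmod_isom_trans h).
Qed.

Lemma fgfree_lsplit (A B C : lmodType R) :
  lmod_fgfree A -> lmod_fgfree C -> lsplit A B C ->
  lmod_fgfree B /\ lrank B = (lrank A + lrank C)%N.
Proof.
move=> [m hm] [n hn] /lsplit_isom h.
have hB : lmod_isom B 'rV[R]_(m + n).
  apply: (lmod_isom_trans h); apply: lmod_isom_trans (rV_prod m n).
  exact: lmod_isom_prod.
by rewrite (lrankE hm) (lrankE hn) (lrankE hB); split=> //; exists (m + n)%N.
Qed.

Lemma fgfree_prod (A B : lmodType R) :
  lmod_fgfree A -> lmod_fgfree B -> lmod_fgfree (A * B)%type.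
Proof. by move=> hA hB; case: (fgfree_lsplit hA hB (lsplit_prod A B)). Qed.

Lemma Ro_fgfree : lmod_fgfree R^o.
Proof. by exists 1%N; apply: Ro_rV1. Qed.

Lemma lmod_zero_isom (M : lmodType R) : (forall m : M, m = 0) -> lmod_isom M 'rV[R]_0.
Proof.
move=> M0; exists \0, (fun=> 0) => m; first by rewrite [LHS]M0 [RHS]M0.
by rewrite [RHS]thinmx0 /=.
Qed.

Lemma fgfree_fgproj (M : lmodType R) : lmod_fgfree M -> lmod_fgproj M.
Proof.
move=> hM; exists 'rV[R]_0; apply: fgfree_prod => //.
by exists 0%N; apply: lmod_isom_refl.
Qed.

(** Closure under retracts is what makes heads of projective modules
    projective: a retraction induces one on heads. *)
Lemma fgproj_retract (M N : lmodType R) (i : {linear M -> N}) (r : {linear N -> M}) :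
  cancel i r -> lmod_fgproj N -> lmod_fgproj M.
Proof.
move=> ir [N' hN']; exists (coker i * N')%type; apply: fgfree_isom hN'.
apply: lmod_isom_trans (lmod_prodA _ _ _) _.
apply: lmod_isom_prod (lmod_isom_refl _).
exact/lmod_isom_sym/(retract_summand ir).
Qed.

Lemma fgproj_prod (M N : lmodType R) :
  lmod_fgproj M -> lmod_fgproj N -> lmod_fgproj (M * N)%type.
Proof.
move=> [M' hM] [N' hN]; exists (M' * N')%type.
apply: fgfree_isom (fgfree_prod hM hN); exact: lmod_prodACA.
Qed.

(** Free modules lift along surjections by lifting basis vectors. *)
Lemma rV_lift n (B C : lmodType R) (p : {linear B -> C}) (f : {linear 'rV[R]_n -> C}) :
  (forall c, exists b, p b = c) ->
  exists g : {linear 'rV[R]_n -> B}, forall v, p (g v) = f v.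
Proof.
move=> p_surj.
pose b j := sval (cid (p_surj (f (delta_mx 0 j)))).
have pb j : p (b j) = f (delta_mx 0 j) by rewrite /b; case: cid.
have lg : linear (fun v : 'rV[R]_n => \sum_j v 0 j *: b j).
  move=> a x y; rewrite scaler_sumr -big_split; apply: eq_bigr => j _.
  by rewrite !mxE scalerDl scalerA.
exists (mkLin lg) => v /=; rewrite [in RHS](row_sum_delta v) !linear_sum.
by apply: eq_bigr => j _; rewrite !linearZ /= pb.
Qed.

Lemma fgproj_section (B C : lmodType R) (p : {linear B -> C}) :
  lmod_fgproj C -> (forall c, exists b, p b = c) ->
  exists s : {linear C -> B}, cancel s p.
Proof.
case=> N [n [f /bij_linear_inv[g [fg _]]]] p_surj.
have [i [_] [r] [_] [ir _ _]] := lsplit_prod C N.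
have [h ph] := rV_lift (r \o g) p_surj.
by exists (h \o f \o i) => c /=; rewrite ph /= fg ir.
Qed.

Lemma fgproj_ses_lsplit (A B C : lmodType R) : lmod_fgproj C ->
  (exists (i : {linear A -> B}) (p : {linear B -> C}), short_exact i p) ->
  lsplit A B C.
Proof.
move=> hC [i] [p] ip; have [_ _ surj] := ip.
have [s sp] := fgproj_section hC surj.
by have [r [ir e]] := ses_lsplit ip sp; exists i, p, r, s.
Qed.

End LinearConstructions.

(** * Projective modules over a principal ideal domain *)

Section PrincipalIdealDomain.
Variable R : comNzRingType.
Hypothesis pidR : is_pid R.

Lemma pid_ideal (I : R -> Prop) :
  I 0 -> (forall a x y, I x -> I y -> I (a * x + y)) ->
  exists2 a, I a & forall x, I x -> exists b, x = b * a.
Proof.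
move=> I0 IP; pose J : {pred R^o} := fun x => `[< I x >].
have J_closed : submod_closed J.
  split=> [|a x y]; first exact/asboolP.
  by move=> /asboolP hx /asboolP hy; apply/asboolP/IP.
pose JS : submodClosed R^o := HB.pack J (GRing.isSubmodClosed.Build R R^o J J_closed).
have [a ha] := pidR.2 JS.
exists a => [|x hx]; last by apply/ha/asboolP.
by apply/asboolP; apply/(ha a); exists 1; rewrite mul1r.
Qed.

(** Induction on the rank: the first coordinates of the submodule form a
    principal ideal, and if it is nonzero then an element attaining its
    generator splits off, leaving the elements with first coordinate 0. *)
Lemma pid_submodule_free n (S : 'rV[R]_n -> Prop) :
  S 0 -> (forall a u v, S u -> S v -> S (a *: u + v)) ->
  exists m (G : 'M[R]_(m, n)),
    (forall w : 'rV_m, w *m G = 0 -> w = 0) /\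
    (forall v, S v <-> exists w : 'rV_m, v = w *m G).
Proof.
elim: n S => [|n IH] S S0 SP.
  exists 0%N, 0; split=> [w _|v]; first exact: thinmx0.
  by rewrite thinmx0; split=> // _; exists 0; rewrite mul0mx.
pose S' (v : 'rV[R]_n) := S (row_mx 0 v : 'rV_(1 + n)).
have [||m [G [injG SG]]] := IH S'.
- by rewrite /S' row_mx0.
- move=> a u v hu hv; rewrite /S'.
  have -> : row_mx 0 (a *: u + v) = a *: row_mx 0 u + row_mx 0 v :> 'rV[R]_(1 + n).
    by rewrite scale_row_mx add_row_mx scaler0 addr0.
  exact: SP.
pose I x := exists v : 'rV[R]_n, S (row_mx (x%:M : 'rV_1) v : 'rV_(1 + n)).
have [||a [v0 Sv0] Ia] := pid_ideal (I := I).
- by exists 0; rewrite (_ : 0%:M = 0 :> 'rV_1) ?row_mx0 // raddf0.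
- move=> b x y [u hu] [v hv]; exists (b *: u + v).
  have -> : row_mx ((b * x + y)%:M : 'rV_1) (b *: u + v) =
     b *: row_mx x%:M u + row_mx y%:M v :> 'rV[R]_(1 + n).
    by rewrite scale_row_mx add_row_mx scale_scalar_mx -raddfD.
  exact: SP.
have SB u v b : S u -> S v -> S (u - b *: v).
  by move=> hu hv; rewrite addrC -scaleNr; apply: SP.
have decomp (v : 'rV[R]_(1 + n)) : exists x (v' : 'rV[R]_n), v = row_mx x%:M v'.
  exists (lsubmx v 0 0), (rsubmx v); rewrite -[LHS]hsubmxK; congr row_mx.
  by rewrite [LHS]mx11_scalar.
have [a0|a0] := eqVneq a 0.
  pose G0 : 'M[R]_(m, 1 + n) := row_mx 0 G.
  have G0E (w : 'rV_m) : w *m G0 = row_mx 0 (w *m G) by rewrite mul_mx_row mulmx0.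
  exists m, G0; split=> [w|v].
    rewrite G0E -(@row_mx0 _ 1 1 n) => e.
    by have [_ /injG] := @eq_row_mx R 1 1 n _ _ _ _ e.
  split=> [Sv|[w ->]]; last by rewrite G0E; apply/SG; exists w.
  have [x [v' ev]] := decomp v; move: Sv; rewrite {}ev => Sv.
  have [b x0] : exists b, x = b * a by apply: Ia; exists v'.
  move: Sv; rewrite x0 a0 mulr0 raddf0 => /SG[w ->].
  by exists w; rewrite G0E.
pose G1 : 'M[R]_(1 + m, 1 + n) := col_mx (row_mx a%:M v0) (row_mx 0 G).
have G1E (c : 'rV_1) (d : 'rV_m) :
    row_mx c d *m G1 = row_mx (c *m a%:M) (c *m v0 + d *m G).
  by rewrite mul_row_col !mul_mx_row mulmx0 add_row_mx addr0.
exists (1 + m)%N, G1; split.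
  move=> w; rewrite -[w]hsubmxK; move: (lsubmx w) (rsubmx w) => c d.
  rewrite G1E -(@row_mx0 _ 1 1 n) => e.
  have [e1 e2] := @eq_row_mx R 1 1 n _ _ _ _ e.
  have c0 : c = 0.
    move: e1; rewrite mul_mx_scalar => /matrixP/(_ 0 0); rewrite !mxE => /eqP.
    move=> /eqP/(pidR.1 _ _); rewrite (negPf a0) /= => /eqP c00.
    by apply/rowP => i; rewrite ord1 c00 mxE.
  by move: e2; rewrite c0 mul0mx add0r => /injG->; rewrite row_mx0.
move=> v; split=> [Sv|[w ->]].
  have [x [v' ev]] := decomp v; move: Sv; rewrite {}ev => Sv.
  have [b xb] : exists b, x = b * a by apply: Ia; exists v'.
  have /SG[w ew] : S' (v' - b *: v0).
    rewrite /S'; have -> : row_mx 0 (v' - b *: v0) =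
       row_mx x%:M v' - b *: row_mx a%:M v0 :> 'rV[R]_(1 + n).
      by rewrite scale_row_mx opp_row_mx add_row_mx xb scale_scalar_mx subrr.
    exact: SB.
  exists (row_mx b%:M w); rewrite G1E.
  by rewrite -ew mul_scalar_mx scale_scalar_mx xb mul_scalar_mx addrC subrK.
rewrite -[w]hsubmxK G1E [lsubmx w]mx11_scalar !mul_scalar_mx.
have -> : row_mx (lsubmx w 0 0 *: a%:M) (lsubmx w 0 0 *: v0 + rsubmx w *m G) =
   lsubmx w 0 0 *: row_mx a%:M v0 + row_mx 0 (rsubmx w *m G) :> 'rV[R]_(1 + n).
  by rewrite scale_row_mx add_row_mx addr0.
by apply: SP => //; apply/SG; exists (rsubmx w).
Qed.

(** A projective module is a submodule of some R^n, as a direct summand. *)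
Lemma pid_fgproj_free (M : lmodType R) : lmod_fgproj M -> lmod_fgfree M.
Proof.
case=> N [n [f /bij_linear_inv[g [fg gf]]]].
have [i [_] [r] [_] [ir _ _]] := lsplit_prod M N.
have [||m [G [injG SG]]] := @pid_submodule_free n (fun v => exists x, v = f (i x)).
- by exists 0; rewrite !linear0.
- by move=> a _ _ [x ->] [y ->]; exists (a *: x + y); rewrite !linearP.
have lG : linear (fun w : 'rV[R]_m => r (g (w *m G))).
  by move=> a x y; rewrite mulmxDl -scalemxAl !linearP.
exists m; apply: lmod_isom_sym; exists (mkLin lG).
have ex x : exists w, f (i x) = w *m G by apply/SG; exists x.
exists (fun x => sval (cid (ex x))) => [w|x] /=; last first.
  by case: cid => w /= <-; rewrite fg ir.
case: cid => w' /= e.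
have /SG[x ex'] : exists w', w *m G = w' *m G by exists w.
move: e; rewrite ex' fg ir -ex' => e.
by apply/eqP; rewrite -subr_eq0; apply/eqP/injG; rewrite mulmxBl e subrr.
Qed.

End PrincipalIdealDomain.

(** * Modules over a category *)

Section CategoryModules.
Variables (R : comNzRingType) (C : category).
Implicit Types (A B D K L M N : rcMod R C).

Definition hid M : rcHom M M :=
  @RCHom R C M M (fun=> idfun) (fun _ _ _ _ => erefl).

Lemma hcomp_nat L M N (g : rcHom M N) (f : rcHom L M) x y (u : mor x y) m :
  (g x \o f x) (rc_act L u m) = rc_act N u ((g y \o f y) m).
Proof. by rewrite /= !rc_nat. Qed.
Definition hcomp L M N (g : rcHom M N) (f : rcHom L M) : rcHom L N :=
  @RCHom R C L N (fun x => g x \o f x) (@hcomp_nat L M N g f).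

Lemma hzero_nat M N x y (u : mor x y) (m : M y) :
  (\0 : {linear M x -> N x}) (rc_act M u m) = rc_act N u (\0 m).
Proof. by rewrite /= linear0. Qed.
Definition hzero M N : rcHom M N := @RCHom R C M N (fun=> \0) (@hzero_nat M N).

Lemma hadd_nat M N (f g : rcHom M N) x y (u : mor x y) m :
  (f x \+ g x) (rc_act M u m) = rc_act N u ((f y \+ g y) m).
Proof. by rewrite /= !rc_nat linearD. Qed.
Definition hadd M N (f g : rcHom M N) : rcHom M N :=
  @RCHom R C M N (fun x => f x \+ g x) (@hadd_nat M N f g).

Lemma hsub_nat M N (f g : rcHom M N) x y (u : mor x y) m :
  (f x \- g x) (rc_act M u m) = rc_act N u ((f y \- g y) m).
Proof. by rewrite /= !rc_nat linearB. Qed.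
Definition hsub M N (f g : rcHom M N) : rcHom M N :=
  @RCHom R C M N (fun x => f x \- g x) (@hsub_nat M N f g).

Definition hpair L M N (f : rcHom L M) (g : rcHom L N) : rcHom L (rc_dsum M N).
Proof.
apply: (@RCHom R C L (rc_dsum M N) (fun x => mkLin (linear_pairing (f x) (g x)))).
by move=> x y u m; rewrite /= /pair_map /= !rc_nat.
Defined.

Definition hfst M N : rcHom (rc_dsum M N) M.
Proof.
by apply: (@RCHom R C (rc_dsum M N) M
  (fun x => @mkLin R (M x * N x)%type (M x) (fun m => m.1) (fun _ _ _ => erefl))).
Defined.

Definition hsnd M N : rcHom (rc_dsum M N) N.
Proof.
by apply: (@RCHom R C (rc_dsum M N) N
  (fun x => @mkLin R (M x * N x)%type (N x) (fun m => m.2) (fun _ _ _ => erefl))).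
Defined.

Definition hinl M N : rcHom M (rc_dsum M N) := hpair (hid M) (hzero M N).
Definition hinr M N : rcHom N (rc_dsum M N) := hpair (hzero N M) (hid N).

Definition hcase L M N (f : rcHom M L) (g : rcHom N L) : rcHom (rc_dsum M N) L :=
  hadd (hcomp f (hfst M N)) (hcomp g (hsnd M N)).

Lemma hom_inverse M N (f : rcHom M N) : (forall x, bijective (f x)) ->
  exists g : rcHom N M, forall x, cancel (f x) (g x) /\ cancel (g x) (f x).
Proof.
move=> bij_f.
have gP x := cid (bij_linear_inv (bij_f x)).
have nat x y (u : mor x y) n :
  sval (gP x) (rc_act N u n) = rc_act M u (sval (gP y) n).
  case: (gP x) (gP y) => [g [fg gf]] [g' [fg' gf']] /=.
  by apply: (can_inj fg); rewrite gf rc_nat gf'.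
by exists (RCHom nat) => x /=; case: (gP x).
Qed.

Lemma rc_isomP M N : rc_isom M N <->
  exists (f : rcHom M N) (g : rcHom N M),
    forall x, cancel (f x) (g x) /\ cancel (g x) (f x).
Proof.
split=> [[f /hom_inverse[g fg]]|[f [g fg]]]; first by exists f, g.
by exists f => x; have [] := fg x; exists (g x).
Qed.

Lemma rc_isom_refl M : rc_isom M M.
Proof. by exists (hid M) => x; exists id. Qed.

Lemma rc_isom_sym M N : rc_isom M N -> rc_isom N M.
Proof.
case/rc_isomP => f [g fg]; apply/rc_isomP; exists g, f => x.
by have [] := fg x.
Qed.

Lemma rc_isom_trans L M N : rc_isom L M -> rc_isom M N -> rc_isom L N.
Proof. by case=> f hf [g hg]; exists (hcomp g f) => x; exact: (bij_comp (hg x) (hf x)). Qed.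

Lemma rc_isom_dsum M M' N N' :
  rc_isom M M' -> rc_isom N N' -> rc_isom (rc_dsum M N) (rc_dsum M' N').
Proof.
case=> f hf [g hg].
exists (hpair (hcomp f (hfst M N)) (hcomp g (hsnd M N))) => x.
have [f' ff' f'f] := hf x; have [g' gg' g'g] := hg x.
by exists (fun m => (f' m.1, g' m.2)) => -[m n] /=; rewrite ?ff' ?gg' ?f'f ?g'g.
Qed.

Lemma rc_dsumC M N : rc_isom (rc_dsum M N) (rc_dsum N M).
Proof.
exists (hpair (hsnd M N) (hfst M N)) => x.
by exists (fun m => (m.2, m.1)) => -[].
Qed.

Lemma rc_dsumA L M N :
  rc_isom (rc_dsum L (rc_dsum M N)) (rc_dsum (rc_dsum L M) N).
Proof.
pose s := hsnd L (rc_dsum M N).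
exists (hpair (hpair (hfst _ _) (hcomp (hfst M N) s)) (hcomp (hsnd M N) s)) => x.
by exists (fun m => (m.1.1, (m.1.2, m.2))) => [[? [? ?]]|[[? ?] ?]].
Qed.

Lemma rc_dsumACA K L M N :
  rc_isom (rc_dsum (rc_dsum K L) (rc_dsum M N))
          (rc_dsum (rc_dsum K M) (rc_dsum L N)).
Proof.
pose f := hfst (rc_dsum K L) (rc_dsum M N).
pose s := hsnd (rc_dsum K L) (rc_dsum M N).
exists (hpair (hpair (hcomp (hfst _ _) f) (hcomp (hfst _ _) s))
              (hpair (hcomp (hsnd _ _) f) (hcomp (hsnd _ _) s))) => x.
by exists (fun m => ((m.1.1, m.2.1), (m.1.2, m.2.2))) => -[[? ?] [? ?]].
Qed.

Lemma rc_dsum_zero M (Z : rcMod R C) : (forall x (z : Z x), z = 0) -> rc_isom (rc_dsum M Z) M.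
Proof.
move=> Z0; exists (hfst M Z) => x; exists (fun m => (m, 0)) => // -[m z].
by rewrite [z]Z0.
Qed.

Definition rc_split A B D : Prop :=
  exists (i : rcHom A B) (p : rcHom B D) (r : rcHom B A) (s : rcHom D B),
  [/\ forall x, cancel (i x) (r x), forall x, cancel (s x) (p x)
    & forall x b, i x (r x b) + s x (p x b) = b].

Lemma rc_split_ses A B D : rc_split A B D -> rc_ses A B D.
Proof.
case=> i [p] [r] [s] [ir sp e]; exists i, p => x.
exact: (split_kernel (ir x) (sp x) (e x)).
Qed.

Lemma isom_rc_split A B D : rc_isom B (rc_dsum A D) -> rc_split A B D.
Proof.
case/rc_isomP => f [g fg].
exists (hcomp g (hinl A D)), (hcomp (hsnd A D) f), (hcomp (hfst A D) f), (hcomp g (hinr A D)).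
split=> [x a|x d|x b] /=; have [fK gK] := fg x; rewrite ?gK //.
rewrite -linearD -[RHS]fK; congr (g x _); case: (f x b) => a d.
by congr pair; rewrite /= ?addr0 ?add0r.
Qed.

Lemma rc_split_isom A B D :
  rc_split A B D -> rc_isom B (rc_dsum A D).
Proof.
case=> i [p] [r] [s] [ir sp e]; exists (hpair r p) => x.
have [_ ker _] := split_kernel (ir x) (sp x) (e x).
exists (fun y => i x y.1 + s x y.2) => [b|[a d]] /=; first exact: e.
have pi0 : p x (i x a) = 0 by apply/ker; exists a.
have rs0 : r x (s x d) = 0.
  apply: (can_inj (ir x)); apply: (addIr (s x (p x (s x d)))).
  by rewrite e linear0 add0r sp.
by rewrite !linearD ir sp pi0 rs0 addr0 add0r.
Qed.

Lemma rc_split_dsum A D : rc_split A (rc_dsum A D) D.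
Proof. exact/isom_rc_split/rc_isom_refl. Qed.

(** The retractions given objectwise are natural because the inclusion of A is
    injective. *)
Lemma rc_ses_section A B D (i : rcHom A B) (p : rcHom B D) (s : rcHom D B) :
  (forall x, short_exact (i x) (p x)) -> (forall x, cancel (s x) (p x)) ->
  rc_split A B D.
Proof.
move=> ip sp; have rP x := cid (ses_lsplit (ip x) (sp x)).
have nat x y (u : mor x y) b :
  sval (rP x) (rc_act B u b) = rc_act A u (sval (rP y) b).
  case: (rP x) (rP y) => [r [ir e]] [r' [ir' e']] /=.
  have [inj_i _ _] := ip x; apply: inj_i; apply: (addIr (s x (p x (rc_act B u b)))).
  by rewrite e !rc_nat -linearD e'.
exists i, p, (RCHom nat), s; split=> // x /=.
  by case: (rP x) => r [].
by case: (rP x) => r [].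
Qed.

(** ** Representable modules and lifting *)

(** Yoneda: an element m of M x determines the map out of the representable
    module that sends the identity of x to m. *)
Lemma yo_nat M (x : C) (m : M x) y z (u : mor y z) (D : Rmor R x z) :
  fmlift (fun p : mor y x => rc_act M p m) (rc_act (Rmor R x) u D)
  = rc_act M u (fmlift (fun p : mor z x => rc_act M p m) D).
Proof.
apply: (@fmlift_uniq _ _ _
  (fmlift (fun p : mor y x => rc_act M p m) \o rc_act (Rmor R x) u)
  (rc_act M u \o fmlift (fun p : mor z x => rc_act M p m))) => p.
by rewrite /= !fmliftU rc_actM.
Qed.

Definition yo M (x : C) (m : M x) : rcHom (Rmor R x) M := RCHom (yo_nat m).

Lemma yoE M (x : C) (m : M x) y (p : mor y x) : yo m y << p >> = rc_act M p m.
Proof. exact: fmliftU. Qed.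

Lemma Rmor_actE (x y z : C) (u : mor y z) (p : mor z x) :
  rc_act (Rmor R x) u << p >> = << mcomp p u >>.
Proof. exact: fmliftU. Qed.

Lemma Rmor_hom_ext M x (f g : rcHom (Rmor R x) M) :
  f x << idm x >> = g x << idm x >> -> forall y, f y =1 g y.
Proof.
move=> e y; apply: fmlift_uniq => p.
have -> : << p >> = rc_act (Rmor R x) p << idm x >> by rewrite Rmor_actE comp1m.
by rewrite !rc_nat e.
Qed.

(** Projectivity of free modules: by Yoneda, lifting a map out of a
    representable module amounts to lifting one element. *)
Lemma bigsum_lift (s : seq C) B D (p : rcHom B D)
    (f : rcHom (rc_bigsum [seq Rmor R x | x <- s]) D) :
  (forall x d, exists b, p x b = d) ->
  exists g : rcHom (rc_bigsum [seq Rmor R x | x <- s]) B,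
    forall x m, p x (g x m) = f x m.
Proof.
move=> p_surj; elim: s f => [|x s IH] /= f.
  by exists (hzero _ _) => x m; rewrite /= !linear0 [m]thinmx0 linear0.
have [g hg] := IH (hcomp f (hinr _ _)).
have [b hb] := p_surj x (f x (hinl (Rmor R x) _ x << idm x >>)).
exists (hcase (yo b) g) => y [m n] /=; rewrite linearD hg /=.
have -> : p y (fmlift (fun q : mor y x => rc_act B q b) m) = f y (m, 0).
  apply: (Rmor_hom_ext (f := hcomp p (yo b)) (g := hcomp f (hinl _ _))).
  by rewrite /= fmliftU rc_act1 hb.
by rewrite -linearD; congr (f y (_, _)); rewrite /= ?addr0 ?add0r.
Qed.

Lemma rc_fgproj_section B D (p : rcHom B D) :
  rc_fgproj D -> (forall x d, exists b, p x b = d) ->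
  exists s : rcHom D B, forall x, cancel (s x) (p x).
Proof.
case=> N [s /rc_isomP[f [g fg]]] p_surj.
have [h ph] := bigsum_lift (hcomp (hfst D N) g) p_surj.
exists (hcomp h (hcomp f (hinl D N))) => x d /=.
by have [fK _] := fg x; rewrite ph /= fK.
Qed.

Lemma fgproj_ses_rc_split A B D : rc_fgproj D -> rc_ses A B D -> rc_split A B D.
Proof.
move=> hD [i [p ip]].
have [|s sp] := rc_fgproj_section (p := p) hD.
  by move=> x; have [] := ip x.
exact: rc_ses_section sp.
Qed.

(** ** Finitely generated free and projective modules *)

Lemma rc_zero0 x (z : rc_zero R C x) : z = 0.
Proof. exact: thinmx0. Qed.

Lemma bigsum_cat (s t : seq C) :
  rc_isom (rc_dsum (rc_bigsum [seq Rmor R x | x <- s]) (rc_bigsum [seq Rmor R x | x <- t]))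
          (rc_bigsum [seq Rmor R x | x <- s ++ t]).
Proof.
elim: s => [|x s IH] /=.
  by apply: rc_isom_trans (rc_dsumC _ _) _; apply/rc_dsum_zero/rc_zero0.
apply: rc_isom_trans (rc_isom_sym (rc_dsumA _ _ _)) _.
exact: rc_isom_dsum (rc_isom_refl _) IH.
Qed.

Lemma rc_fgfree_isom M N : rc_isom M N -> rc_fgfree N -> rc_fgfree M.
Proof. by move=> h [s hs]; exists s; apply: rc_isom_trans hs. Qed.

Lemma rc_fgfree_dsum M N : rc_fgfree M -> rc_fgfree N -> rc_fgfree (rc_dsum M N).
Proof.
move=> [s hs] [t ht]; exists (s ++ t).
by apply: rc_isom_trans (bigsum_cat s t); apply: rc_isom_dsum.
Qed.

Lemma bigsum_fgfree (s : seq C) : rc_fgfree (rc_bigsum [seq Rmor R x | x <- s]).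
Proof. by exists s; apply: rc_isom_refl. Qed.

Lemma Rmor_fgfree (x : C) : rc_fgfree (Rmor R x).
Proof.
exists [:: x]; apply/rc_isom_sym/rc_dsum_zero/rc_zero0.
Qed.

Lemma rc_fgfree_fgproj M : rc_fgfree M -> rc_fgproj M.
Proof.
move=> hM; exists (rc_zero R C); apply: rc_fgfree_isom hM.
exact/rc_dsum_zero/rc_zero0.
Qed.

Lemma rc_fgproj_isom M N : rc_isom M N -> rc_fgproj N -> rc_fgproj M.
Proof.
move=> h [N' hN']; exists N'; apply: rc_fgfree_isom hN'.
exact: rc_isom_dsum (rc_isom_refl _).
Qed.

Lemma rc_fgproj_dsum M N : rc_fgproj M -> rc_fgproj N -> rc_fgproj (rc_dsum M N).
Proof.
move=> [M' hM] [N' hN]; exists (rc_dsum M' N').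
by apply: rc_fgfree_isom (rc_dsumACA _ _ _ _) _; apply: rc_fgfree_dsum.
Qed.

Lemma rc_fgproj_summand M N : rc_fgproj (rc_dsum M N) -> rc_fgproj M.
Proof.
move=> [N' hN']; exists (rc_dsum N N'); apply: rc_fgfree_isom hN'.
exact: rc_dsumA.
Qed.

End CategoryModules.

(** * Tensor products with representable modules *)

Section TensorLift.
Variable R : comNzRingType.

(** Induction for spans, with a predicate in Prop. *)
Lemma lspan_min (V : lmodType R) (S P : V -> Prop) :
  P 0 -> (forall a u v, P u -> P v -> P (a *: u + v)) ->
  (forall s, S s -> P s) -> forall v, v \in lspan S -> P v.
Proof.
move=> P0 PD SP v /asboolP Sv.
pose p : {pred V} := fun u => `[< P u >].
have p_closed : submod_closed p.
  by split=> [|a x y]; [apply/asboolP | move=> /asboolP hx /asboolP hy; apply/asboolP/PD].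
pose W : submodClosed V := HB.pack p (GRing.isSubmodClosed.Build R V p p_closed).
by apply/asboolP/(Sv W) => s Ss; apply/asboolP/SP.
Qed.

Section Lift.
Variables (M N W : lmodType R) (b : M -> N -> W).
Hypotheses (bl : forall n, linear (b^~ n)) (br : forall m, linear (b m)).

Lemma tensor_lift_ex :
  exists f : {linear tensor M N -> W}, forall m n, f (tens m n) = b m n.
Proof.
pose g : {linear {freeg (M * N)%type / R} -> W} := fmlift (fun p => b p.1 p.2).
have gE m n : g << (m, n) >> = b m n by exact: fmliftU.
have g0 v : v \in lspan (@bilinear_rel R M N) -> g v = 0.
  move: v; apply: (lspan_min (P := fun v => g v = 0)).
  - exact: linear0.
  - by move=> a u v gu gv; rewrite linearP gu gv scaler0 addr0.
  move=> _ [m m' n|m n n'|c m n|c m n].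
  - rewrite !linearB !gE /= (_ : b (m + m') n = b m n + b m' n).
      by rewrite addrAC addrK subrr.
    by have := bl n 1 m m'; rewrite !scale1r.
  - rewrite !linearB !gE /= (_ : b m (n + n') = b m n + b m n').
      by rewrite addrAC addrK subrr.
    by have := br m 1 n n'; rewrite !scale1r.
  - rewrite linearB linearZ !gE /= (_ : b (c *: m) n = c *: b m n) ?subrr //.
    by have := linearZ_LR (mkLin (bl n)) c m.
  - rewrite linearB linearZ !gE /= (_ : b m (c *: n) = c *: b m n) ?subrr //.
    by have := linearZ_LR (mkLin (br m)) c n.
exists (quot_lift g0) => m n; rewrite -gE; exact: quot_lift_pi g0 _.
Qed.

End Lift.

Lemma tens_linearl (M N : lmodType R) (n : N) :
  linear (fun m : M => tens m n).
Proof.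
pose q : {linear _ -> tensor M N} := quot_pi (lspan (@bilinear_rel R M N)).
have q0 v : bilinear_rel v -> q v = 0 by move=> h; apply/quot_pi_eq0/mem_lspan.
move=> a m m'.
have := q0 _ (bil_addl (a *: m) m' n); have := q0 _ (bil_scalel a m n).
rewrite !linearB linearZ -![q << _ >>]/(tens _ _) => /eqP.
rewrite subr_eq0 => /eqP <- /eqP.
by rewrite -addrA -opprD subr_eq0 => /eqP.
Qed.

Lemma tens_linearr (M N : lmodType R) (m : M) : linear (tens m : N -> _).
Proof.
pose q : {linear _ -> tensor M N} := quot_pi (lspan (@bilinear_rel R M N)).
have q0 v : bilinear_rel v -> q v = 0 by move=> h; apply/quot_pi_eq0/mem_lspan.
move=> a n n'.
have := q0 _ (bil_addr m (a *: n) n'); have := q0 _ (bil_scaler a m n).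
rewrite !linearB linearZ -![q << _ >>]/(tens _ _) => /eqP.
rewrite subr_eq0 => /eqP <- /eqP.
by rewrite -addrA -opprD subr_eq0 => /eqP.
Qed.

(** Tensors with basis vectors generate the tensor product with a free module,
    so that maps out of an extension E_x(Q) are compared on arrows. *)
Lemma tensor_freeg_ext (Q : lmodType R) (K : choiceType) (W : lmodType R)
    (f g : {linear tensor Q {freeg K / R} -> W}) :
  (forall q k, f (tens q << k >>) = g (tens q << k >>)) -> f =1 g.
Proof.
move=> fg; apply: tensor_ind_eq => q.
apply: (@fmlift_uniq R K W (f \o mkLin (tens_linearr q)) (g \o mkLin (tens_linearr q))) => k.
exact: fg.
Qed.

End TensorLift.

Section Extension.
Variables (R : comNzRingType) (C : category) (x : C).
Implicit Types (Q : lmodType R) (M : rcMod R C).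

Definition ext_gen Q : {linear Q -> extE x Q x} :=
  mkLin (tens_linearl (<< idm x >> : Rmor R x x)).

Lemma ext_act Q y z (u : mor y z) q (k : mor z x) :
  rc_act (extE x Q) u (tens q << k >>) = tens q << mcomp k u >>.
Proof.
by rewrite (tensor_mapE (rc_act (Rmor R x) u) q << k >>) Rmor_actE.
Qed.

Lemma ext_act_gen Q y (k : mor y x) q :
  tens q << k >> = rc_act (extE x Q) k (ext_gen Q q).
Proof. by rewrite ext_act comp1m. Qed.

(** The universal property of the extension functor; the uniqueness part is
    [ext_hom_ext]. *)
Lemma ext_lift_ex Q M (s : {linear Q -> M x}) :
  exists f : rcHom (extE x Q) M, forall q, f x (ext_gen Q q) = s q.
Proof.
have bl y (D : Rmor R x y) : linear (fun q => yo (s q) y D).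
  move=> a q q'.
  have lc : linear (fun D => a *: yo (s q) y D + yo (s q') y D).
    move=> b D1 D2; rewrite (linearP (yo (s q) y)) (linearP (yo (s q') y)).
    by rewrite !scalerDr !scalerA [b * a]mulrC addrACA.
  apply: (@fmlift_uniq _ _ _ (yo (s (a *: q + q')) y) (mkLin lc)) => k.
  by rewrite /= !fmliftU !linearP.
have br y q : linear (fun D => yo (s q) y D) by move=> a D D'; rewrite linearP.
have fP y := cid (tensor_lift_ex (bl y) (br y)).
have fE y q k : sval (fP y) (tens q << k >>) = rc_act M k (s q).
  by case: (fP y) => f /= ->; rewrite fmliftU.
have nat y z (u : mor y z) m :
  sval (fP y) (rc_act (extE x Q) u m) = rc_act M u (sval (fP z) m).
  apply: (@tensor_freeg_ext _ _ _ _ (sval (fP y) \o rc_act (extE x Q) u)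
            (rc_act M u \o sval (fP z))) => q k.
  by rewrite [LHS](congr1 (sval (fP y)) (ext_act u q k)) [RHS](congr1 _ (fE z q k)) fE rc_actM.
exists (RCHom nat) => q; rewrite -[RHS]rc_act1; exact: fE.
Qed.

Lemma ext_hom_ext Q M (f g : rcHom (extE x Q) M) :
  (forall q, f x (ext_gen Q q) = g x (ext_gen Q q)) -> forall y, f y =1 g y.
Proof.
move=> fg y; apply: tensor_freeg_ext => q k.
by rewrite ext_act_gen !rc_nat fg.
Qed.

Definition ext_lift Q M (s : {linear Q -> M x}) : rcHom (extE x Q) M :=
  sval (cid (ext_lift_ex s)).

Lemma ext_liftE Q M (s : {linear Q -> M x}) q :
  ext_lift s x (ext_gen Q q) = s q.
Proof. by rewrite /ext_lift; case: cid. Qed.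

Definition ext_map Q Q' (f : {linear Q -> Q'}) : rcHom (extE x Q) (extE x Q') :=
  ext_lift (ext_gen Q' \o f).

Lemma ext_mapE Q Q' (f : {linear Q -> Q'}) q :
  ext_map f x (ext_gen Q q) = ext_gen Q' (f q).
Proof. exact: ext_liftE. Qed.

Lemma ext_mapD Q Q' (f g h : {linear Q -> Q'}) : (forall q, h q = f q + g q) ->
  forall y m, ext_map h y m = ext_map f y m + ext_map g y m.
Proof.
move=> e y m.
rewrite (@ext_hom_ext _ _ (ext_map h) (hadd (ext_map f) (ext_map g))) // => q.
by rewrite [RHS](congr2 +%R (ext_mapE f q) (ext_mapE g q)) ext_mapE e linearD.
Qed.

Lemma ext_map_comp Q Q' Q'' (f : {linear Q -> Q'}) (g : {linear Q' -> Q''})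
    (h : {linear Q -> Q''}) : (forall q, h q = g (f q)) ->
  forall y m, ext_map h y m = ext_map g y (ext_map f y m).
Proof.
move=> e y m.
rewrite (@ext_hom_ext _ _ (ext_map h) (hcomp (ext_map g) (ext_map f))) // => q.
by rewrite [RHS](congr1 (ext_map g x) (ext_mapE f q)) !ext_mapE e.
Qed.

Lemma ext_map_id Q (f : {linear Q -> Q}) : (forall q, f q = q) ->
  forall y m, ext_map f y m = m.
Proof.
move=> e y m; rewrite (@ext_hom_ext _ _ (ext_map f) (hid _)) // => q.
by rewrite ext_mapE e.
Qed.

(** When x has no other endomorphism, Q is recovered as the value at x. *)
Lemma ext_gen_bij Q : (forall k : mor x x, k = idm x) ->
  exists d : {linear extE x Q x -> Q}, cancel (ext_gen Q) d /\ cancel d (ext_gen Q).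
Proof.
move=> end_id.
have bl (D : Rmor R x x) : linear (fun q : Q => fmlift (fun=> q) D).
  move=> a q q'.
  have lc : linear (fun D : Rmor R x x => a *: fmlift (fun=> q) D + fmlift (fun=> q') D).
    move=> b D1 D2; rewrite (linearP (fmlift (fun=> q))) (linearP (fmlift (fun=> q'))).
    by rewrite !scalerDr !scalerA [b * a]mulrC addrACA.
  apply: (@fmlift_uniq _ _ _ (fmlift (fun=> a *: q + q')) (mkLin lc)) => k.
  by rewrite /= !fmliftU.
have br (q : Q) : linear (fun D : Rmor R x x => fmlift (fun=> q) D).
  by move=> a D D'; rewrite linearP.
have [d dE] := tensor_lift_ex bl br.
have dK : cancel (ext_gen Q) d by move=> q; rewrite /= dE fmliftU.
exists d; split=> //.
apply: (@tensor_freeg_ext _ _ _ _ (ext_gen Q \o d) idfun) => q k.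
by rewrite /= dE fmliftU (end_id k).
Qed.

(** Both modules represent the functor sending M to the value M x. *)
Lemma ext_Rmor : rc_isom (extE x (R^o : lmodType R)) (Rmor R x).
Proof.
pose s := mkLin (scale_linear (<< idm x >> : Rmor R x x)).
pose f := ext_lift s; pose g := yo (ext_gen R^o 1).
apply/rc_isomP; exists f, g => y; split.
  move=> m; apply: (ext_hom_ext (f := hcomp g f) (g := hid _)) => q.
  rewrite [LHS](congr1 (g x) (ext_liftE s q)) [LHS]linearZ_LR yoE rc_act1 -linearZ_LR.
  by congr (ext_gen _ _); rewrite /= [LHS]mulr1.
move=> m; apply: (Rmor_hom_ext (f := hcomp f g) (g := hid _)).
rewrite [LHS](congr1 (f x) (yoE (ext_gen R^o 1) (idm x))) rc_act1.
by rewrite ext_liftE /= scale1r.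
Qed.

End Extension.

(** * Heads and standard modules over the category with four objects *)

Section FourObjects.
Variable R : comNzRingType.
Implicit Types (M N L : rcMod R AAcat) (Q V : lmodType R).

(** At a1, a2 and a4 this is the submodule generated by the images of the
    non-isomorphisms, and at a3 the image of f34. An f-arrow out of a1 or a2
    factors through a3, so that one arrow to a3 and the g-arrows suffice. *)
Definition in_rad M (i : obA) : M i -> Prop :=
  match i return M i -> Prop with
  | a1 => fun m => exists y z, m = rc_act M (f13 : mor (a1 : AAcat) a3) y
                           + rc_act M (g12 : mor (a1 : AAcat) a2) z
  | a2 => fun m => exists y w v, m = rc_act M (f23 : mor (a2 : AAcat) a3) y
                             + rc_act M (g21 : mor (a2 : AAcat) a1) w
                             + rc_act M (g24 : mor (a2 : AAcat) a4) v
  | a3 => fun m => exists v, m = rc_act M (f34 : mor (a3 : AAcat) a4) v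
  | a4 => fun m => m = 0
  end.

Lemma in_rad_comb M i a (m n : M i) :
  in_rad m -> in_rad n -> in_rad (a *: m + n).
Proof.
case: i m n => m n /=.
- move=> [y [z ->]] [y' [z' ->]]; exists (a *: y + y'), (a *: z + z').
  by rewrite !linearP scalerDr addrACA.
- move=> [y [w [v ->]]] [y' [w' [v' ->]]].
  exists (a *: y + y'), (a *: w + w'), (a *: v + v').
  rewrite !linearP !scalerDr.
  by rewrite [LHS]addrACA; congr (_ + _); rewrite [LHS]addrACA.
- by move=> [v ->] [v' ->]; exists (a *: v + v'); rewrite linearP.
- by move=> -> ->; rewrite scaler0 addr0.
Qed.

Lemma in_rad0 M i : in_rad (0 : M i).
Proof.
case: i => //=.
- by exists 0, 0; rewrite !linear0 addr0.
- by exists 0, 0, 0; rewrite !linear0 !addr0.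
- by exists 0; rewrite linear0.
Qed.

Lemma in_rad_nat M N (f : rcHom M N) i (m : M i) : in_rad m -> in_rad (f i m).
Proof.
case: i m => m /=.
- by move=> [y [z ->]]; exists (f _ y), (f _ z); rewrite linearD !rc_nat.
- move=> [y [w [v ->]]]; exists (f _ y), (f _ w), (f _ v).
  by rewrite !linearD !rc_nat.
- by move=> [v ->]; exists (f _ v); rewrite rc_nat.
- by move->; rewrite linear0.
Qed.

Definition isA3 (x : obA) := if x is a3 then true else false.
Definition isA4 (x : obA) := if x is a4 then true else false.

(** At a3 only the arrow f34 counts, because f31 and f32 act by surjections
    onto the value at a3. *)
Lemma act_in_rad M (i z : obA) (k : morA i z) (n : M z) :
  (if isA3 i then isA4 z else ~~ is_idA k) ->
  in_rad (rc_act M (k : mor (i : AAcat) z) n).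
Proof.
case: i k => k; move: z k n.
- have f_rad z n : in_rad (rc_act M (fA1 z : mor (a1 : AAcat) z) n).
    exists (rc_act M (fA3 z : mor (a3 : AAcat) z) n), 0.
    by rewrite linear0 addr0 -rc_actM.
  apply: morA_from1 => [||z] n // _.
  by exists 0, n; rewrite linear0 add0r.
- have f_rad z n : in_rad (rc_act M (fA2 z : mor (a2 : AAcat) z) n).
    exists (rc_act M (fA3 z : mor (a3 : AAcat) z) n), 0, 0.
    by rewrite !linear0 !addr0 -rc_actM.
  apply: morA_from2 => [|||z] n // _.
    by exists 0, n, 0; rewrite !linear0 add0r addr0.
  by exists 0, 0, n; rewrite !linear0 !add0r.
- by apply: morA_from3 => -[] n // _; exists n.
- by apply: morA_from4.
Qed.

Lemma idA_iso (x y : obA) (u : morA x y) : is_idA u -> is_iso (u : mor (x : AAcat) y).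
Proof. by case: x y / u => // _; [exists id1|exists id2|exists f33|exists f44]. Qed.

Lemma not_iso_of_comp (x y : obA) (u : morA x y) :
  (forall z (v : morA y z), ~~ is_idA (compA v u)) -> ~ is_iso (u : mor (x : AAcat) y).
Proof.
move=> h [v [e _]]; have := h _ v.
by rewrite [compA v u]e /idm /=; case: (x).
Qed.

(** The functors S_a1, S_a2, coker f34 and S_a4, in this order. *)
Definition head (i : obA) M : lmodType R :=
  match i with
  | a3 => coker (rc_act M (f34 : mor (a3 : AAcat) a4))
  | a1 => splitS (a1 : AAcat) M
  | a2 => splitS (a2 : AAcat) M
  | a4 => splitS (a4 : AAcat) M
  end.

Definition hd (i : obA) M : {linear M i -> head i M} :=
  match i return {linear M i -> head i M} with
  | a3 => quot_pi _
  | _ => quot_pi _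
  end.

Lemma hd_surj i M (x : head i M) : exists m, hd i M m = x.
Proof. by case: i x => x; exact: quot_pi_surj. Qed.

(** The concrete description of the kernel of the projection to the head; all
    later arguments about heads go through it. *)
Lemma hd0P i M (m : M i) : hd i M m = 0 <-> in_rad m.
Proof.
pose S (x : obA) (n : M x) := exists (y : AAcat) (u : mor (x : AAcat) y) (k : M y),
  ~ is_iso u /\ n = rc_act M u k.
have gen_rad x n : ~~ isA3 x -> S x n -> in_rad n.
  move=> x3 [y [u [k [u_iso ->]]]]; apply: act_in_rad; rewrite (negPf x3).
  by apply/negP => /idA_iso.
have span_rad x n : ~~ isA3 x -> n \in lspan (S x) -> in_rad n.
  move=> x3; move: n; apply: (lspan_min (P := @in_rad M x)) => [|a u v|s]; first exact: in_rad0.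
    exact: in_rad_comb.
  exact: gen_rad.
have memS x y (u : mor (x : AAcat) y) k : ~ is_iso u -> rc_act M u k \in lspan (S x).
  by move=> u_iso; apply: mem_lspan; exists y, u, k.
case: i m => m; split.
- by move/quot_pi_ker; apply: span_rad.
- move=> [y [z ->]]; apply: quot_pi_eq0; apply: rpredD; apply: memS; apply: not_iso_of_comp.
    by case.
  by apply: morA_from2 => [|||[]].
- by move/quot_pi_ker; apply: span_rad.
- move=> [y [w [v ->]]]; apply: quot_pi_eq0.
  apply: rpredD; [apply: rpredD|]; apply: memS; apply: not_iso_of_comp.
  + by case.
  + by apply: morA_from1 => [||[]].
  + by apply: morA_from4.
- by move=> /quot_pi_ker/asboolP[v]; exists v.
- by move=> [v ->]; apply: quot_pi_eq0; apply/asboolP; exists v.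
- by move/quot_pi_ker; apply: span_rad.
- by move=> ->; rewrite linear0.
Qed.

Lemma hd_lift i M (W : lmodType R) (g : {linear M i -> W}) : (forall m, in_rad m -> g m = 0) ->
  exists g' : {linear head i M -> W}, forall m, g' (hd i M m) = g m.
Proof.
move=> g0.
have lift (I : submodClosed (M i)) : (forall m, m \in I -> in_rad m) ->
    exists g' : {linear lquot I -> W}, forall m, g' (quot_pi I m) = g m.
  move=> Irad; have g0' m : m \in I -> g m = 0 by move/Irad/g0.
  by exists (quot_lift g0') => m; apply: (quot_lift_pi g0').
move: lift; case: i g g0 => g g0; apply=> m mI;
  by apply/(hd0P (i := _)); apply: quot_pi_eq0.
Qed.

Lemma head_map i M N (f : rcHom M N) :
  exists g : {linear head i M -> head i N}, forall m, g (hd i M m) = hd i N (f i m).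
Proof.
apply: (hd_lift (g := hd i N \o f i)) => m rm /=.
exact/hd0P/in_rad_nat.
Qed.

Lemma head_isom i M N : rc_isom M N -> lmod_isom (head i M) (head i N).
Proof.
case/rc_isomP => f [g fg]; have [fK gK] := fg (i : AAcat).
have [f' f'E] := head_map i f; have [g' g'E] := head_map i g.
by exists f', g' => x; have [m <-] := hd_surj x; rewrite ?f'E ?g'E ?f'E ?fK ?gK.
Qed.

Lemma head_split i L M N : rc_split L M N -> lsplit (head i L) (head i M) (head i N).
Proof.
case=> j [p] [r] [s] [jr sp e].
have [j' j'E] := head_map i j; have [p' p'E] := head_map i p.
have [r' r'E] := head_map i r; have [s' s'E] := head_map i s.
exists j', p', r', s'; split=> x; have [m <-] := hd_surj x.
- by rewrite j'E r'E jr.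
- by rewrite s'E p'E sp.
- by rewrite r'E p'E j'E s'E -linearD e.
Qed.

(** ** The square of the radical is zero *)

(** At a4 the radical is zero, and at a3 it comes from a4. At a1 and a2 the
    part of m that comes from a3 is sent to 0 by the case of a3. On the
    complementary part m - f11 m, naturality shows that f takes values in
    the image of g12 - f12. Applying g to such a value gives the action of
    g12 - f12 on an element of the radical at a2, which is zero. The case of
    a2 is similar. *)
Lemma rad_square_zero L M N (f : rcHom L M) (g : rcHom M N) :
  (forall i m, in_rad (f i m)) -> (forall i m, in_rad (g i m)) ->
  forall (i : obA) m, g i (f i m) = 0.
Proof.
move=> fr gr.
have g4 m : g a4 m = 0 := gr a4 m.
have gf3 m : g a3 (f a3 m) = 0.
  by have [v ->] := fr a3 m; rewrite rc_nat g4 linear0.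
case=> m; rewrite ?g4 ?gf3 //.
- have gf_f11 : g a1 (f a1 (rc_act L (f11 : mor (a1 : AAcat) a1) m)) = 0.
    rewrite (rc_actM (f13 : mor (a1 : AAcat) a3) (f31 : mor (a3 : AAcat) a1)).
    rewrite (rc_nat f (f13 : mor (a1 : AAcat) a3)).
    by rewrite (rc_nat g (f13 : mor (a1 : AAcat) a3)) gf3 linear0.
  have [y [z fm]] := fr a1 m.
  have [y' [w [v gz]]] := gr a2 z.
  have e : f a1 m - f a1 (rc_act L (f11 : mor (a1 : AAcat) a1) m)
     = rc_act M (g12 : mor (a1 : AAcat) a2) z - rc_act M (f12 : mor (a1 : AAcat) a2) z.
    rewrite rc_nat fm (linearD (rc_act M _)) -!rc_actM /=.
    by rewrite opprD addrACA subrr add0r.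
  have : g a1 (f a1 m - f a1 (rc_act L (f11 : mor (a1 : AAcat) a1) m)) = 0.
    by rewrite e linearB !rc_nat gz !linearD -!rc_actM /= -!opprD subrr.
  by rewrite linearB gf_f11 subr0.
- have gf_f22 : g a2 (f a2 (rc_act L (f22 : mor (a2 : AAcat) a2) m)) = 0.
    rewrite (rc_actM (f23 : mor (a2 : AAcat) a3) (f32 : mor (a3 : AAcat) a2)).
    rewrite (rc_nat f (f23 : mor (a2 : AAcat) a3)).
    by rewrite (rc_nat g (f23 : mor (a2 : AAcat) a3)) gf3 linear0.
  have [y [w [v fm]]] := fr a2 m.
  have [y' [z' gw]] := gr a1 w.
  have e : f a2 m - f a2 (rc_act L (f22 : mor (a2 : AAcat) a2) m)
     = (rc_act M (g21 : mor (a2 : AAcat) a1) w - rc_act M (f21 : mor (a2 : AAcat) a1) w)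
     + (rc_act M (g24 : mor (a2 : AAcat) a4) v - rc_act M (f24 : mor (a2 : AAcat) a4) v).
    rewrite rc_nat fm !(linearD (rc_act M _)) -!rc_actM /=.
    rewrite !opprD [LHS]addrACA; congr (_ + _).
    by rewrite [LHS]addrACA subrr add0r.
  have : g a2 (f a2 m - f a2 (rc_act L (f22 : mor (a2 : AAcat) a2) m)) = 0.
    rewrite e linearD !linearB !rc_nat !g4 !linear0 !addr0.
    by rewrite gw !linearD -!rc_actM /= -!opprD subrr.
  by rewrite linearB gf_f22 subr0.
Qed.

(** The form of Nakayama's lemma that is needed: the composites of f and g
    differ from the identities by maps into the radical, the squares of these
    differences vanish, and so the composites are invertible. *)
Lemma head_inverse_isom M N (f : rcHom M N) (g : rcHom N M) :
  (forall i m, hd i M (g i (f i m)) = hd i M m) ->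
  (forall i n, hd i N (f i (g i n)) = hd i N n) ->
  rc_isom M N.
Proof.
move=> gf fg.
have sq0 K (h : rcHom K K) : (forall i k, hd i K (h i k) = hd i K k) ->
    forall (i : obA) k, h i (h i k) - h i k - (h i k - k) = 0.
  move=> hK i k; have dr j l : in_rad (hsub h (hid K) j l).
    by apply/hd0P; rewrite /= linearB hK subrr.
  have := rad_square_zero dr dr k.
  by rewrite /= linearB.
exists f => i; have inj_f : injective (f i).
  move=> m m' e; apply/eqP; rewrite -subr_eq0; apply/eqP.
  have := sq0 _ (hcomp g f) gf i (m - m').
  by rewrite /= (linearB (f i)) e subrr !linear0 !add0r opprK.
have surj_f n : exists m, f i m = n.
  exists (g i n + g i n - g i (f i (g i n))).
  have /eqP := sq0 _ (hcomp f g) fg i n.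
  rewrite subr_eq0 (linearB (f i)) (linearD (f i)) /= => /eqP e.
  by rewrite -addrA -opprB e subKr.
exists (fun n => sval (cid (surj_f n))) => [m|n]; last by case: cid.
by case: cid => m' /= /inj_f.
Qed.

(** ** The four standard modules *)

Definition K_map Q Q' (f : {linear Q -> Q'}) (x : obA) :
    {linear Kval Q x -> Kval Q' x} :=
  match x with a1 | a2 => f | a3 | a4 => lid _ end.

Lemma K_map_nat first Q Q' (f : {linear Q -> Q'}) (x y : obA) (u : morA x y) m :
  K_map f x (Kact Q first u m) = Kact Q' first u (K_map f y m).
Proof. by case: x y / u m => m; case: first; rewrite /= ?linear0. Qed.

Definition K_hom first Q Q' (f : {linear Q -> Q'}) :
    rcHom (Kmod Q first) (Kmod Q' first) :=
  @RCHom R AAcat (Kmod Q first) (Kmod Q' first) (K_map f) (@K_map_nat first Q Q' f).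

(** The projective module attached to the object j, with top Q. *)
Definition std (j : obA) Q : rcMod R AAcat :=
  match j with
  | a1 => K1 Q | a2 => K2 Q
  | a3 => extE (a3 : AAcat) Q | a4 => extE (a4 : AAcat) Q
  end.

Definition std_map (j : obA) Q Q' (f : {linear Q -> Q'}) : rcHom (std j Q) (std j Q') :=
  match j return rcHom (std j Q) (std j Q') with
  | a1 => K_hom true f | a2 => K_hom false f
  | a3 => ext_map (a3 : AAcat) f | a4 => ext_map (a4 : AAcat) f
  end.

Definition std_gen (j : obA) Q : {linear Q -> std j Q j} :=
  match j return {linear Q -> std j Q j} with
  | a1 => lid Q | a2 => lid Q
  | a3 => ext_gen (a3 : AAcat) Q | a4 => ext_gen (a4 : AAcat) Q
  end.

Lemma std_map_gen j Q Q' (f : {linear Q -> Q'}) q :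
  std_map j f j (std_gen j Q q) = std_gen j Q' (f q).
Proof. by case: j => //; apply: ext_mapE. Qed.

Lemma K_homD first Q Q' (f g h : {linear Q -> Q'}) :
  (forall q, h q = f q + g q) ->
  forall (i : obA) m, K_hom first h i m = K_hom first f i m + K_hom first g i m.
Proof. by move=> e [] m /=; rewrite ?e // [LHS]thinmx0 [RHS]thinmx0. Qed.

Lemma std_mapD j Q Q' (f g h : {linear Q -> Q'}) :
  (forall q, h q = f q + g q) ->
  forall (i : obA) m, std_map j h i m = std_map j f i m + std_map j g i m.
Proof.
move=> e; case: j.
3,4: by move=> i m; exact: (ext_mapD e m).
  exact: K_homD.
exact: K_homD.
Qed.

Lemma std_map_comp j Q Q' Q'' (f : {linear Q -> Q'}) (g : {linear Q' -> Q''})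
    (h : {linear Q -> Q''}) :
  (forall q, h q = g (f q)) ->
  forall (i : obA) m, std_map j h i m = std_map j g i (std_map j f i m).
Proof.
move=> e; case: j.
3,4: by move=> i m; exact: (ext_map_comp e m).
  by case=> m //=.
by case=> m //=.
Qed.

Lemma std_map_id j Q (f : {linear Q -> Q}) : (forall q, f q = q) ->
  forall (i : obA) m, std_map j f i m = m.
Proof.
move=> e; case: j.
3,4: by move=> i m; exact: (ext_map_id e m).
  by case=> m //=.
by case=> m //=.
Qed.

Lemma endA3 (k : morA a3 a3) : k = f33.
Proof.
have h z (v : morA a3 z) :
    match z return morA a3 z -> Prop with a3 => eq^~ f33 | _ => fun=> True end v.
  by move: z v; apply: morA_from3 => -[].
exact: h k.
Qed.

Lemma endA4 (k : morA a4 a4) : k = f44.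
Proof.
have h z (v : morA a4 z) :
    match z return morA a4 z -> Prop with a4 => eq^~ f44 | _ => fun=> True end v.
  by move: z v; apply: morA_from4.
exact: h k.
Qed.

Lemma from_a4_to_a4 (z : obA) (k : morA a4 z) : isA4 z.
Proof. by move: z k; apply: morA_from4. Qed.

(** With [std_rad0], this computes the j-th head of [std j Q]. *)
Lemma std_gen_bij j Q :
  exists d : {linear std j Q j -> Q}, cancel (std_gen j Q) d /\ cancel d (std_gen j Q).
Proof.
case: j => /=; do ?by exists (lid Q).
  exact/ext_gen_bij/endA3.
exact/ext_gen_bij/endA4.
Qed.

(** For j = 3, the module E_a3(Q) vanishes at a4, from which the radical at a3
    would come. *)
Lemma std_rad0 j Q (m : std j Q j) : in_rad m -> m = 0.
Proof.
case: j m => m.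
- by move=> [y [z ->]] /=; rewrite addr0.
- by move=> [y [w [v ->]]] /=; rewrite !addr0.
- move=> [v ->]; suff -> : v = 0 by rewrite linear0.
  move: v; apply: (@tensor_freeg_ext _ _ _ _ idfun \0) => q k.
  by have := from_a4_to_a4 k.
- by [].
Qed.

(** Away from j the module [std j Q] is generated by its value at j, through
    arrows that are not isomorphisms (g21 for K_1, g12 for K_2). *)
Lemma std_in_rad i j Q (m : std j Q i) : i <> j -> in_rad m.
Proof.
have ext_rad (x : obA) (n : extE (x : AAcat) Q (i : AAcat)) :
    (forall k : morA i x, if isA3 i then isA4 x else ~~ is_idA k) -> in_rad n.
  move=> hk; apply/hd0P; move: n.
  apply: (@tensor_freeg_ext _ _ _ _ (hd i (extE (x : AAcat) Q)) \0) => q k.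
  rewrite ext_act_gen; apply/hd0P/act_in_rad/hk.
have id_eq (x : obA) (k : morA i x) : is_idA k -> i = x by case: i x / k {m ext_rad}.
have nid x (k : morA i x) : i <> x -> ~~ is_idA k.
  by move=> ix; apply/negP => /id_eq.
case: j m => m ij.
- case: i ij m {ext_rad id_eq nid} => // _ m.
  + by exists 0, m, 0; rewrite !linear0 add0r addr0.
  + by exists 0; exact: etrans (thinmx0 m) (esym (thinmx0 _)).
  + exact: thinmx0.
- case: i ij m {ext_rad id_eq nid} => // _ m.
  + by exists 0, m; rewrite linear0 add0r.
  + by exists 0; exact: etrans (thinmx0 m) (esym (thinmx0 _)).
  + exact: thinmx0.
- apply: ext_rad => k; case: ifP => [i3|_]; last exact: nid.
  by case: ij; case: (i) i3.
- by apply: ext_rad => k; case: ifP => // _; exact: nid.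
Qed.

End FourObjects.

(** * Projective modules are sums of standard modules *)

Section Decomposition.
Variable R : comNzRingType.
Implicit Types (M N L : rcMod R AAcat) (Q V : lmodType R).

Definition sum4 (V : nmodType) (w : obA -> V) : V := w a1 + w a2 + w a3 + w a4.

Lemma sum4_only (V : nmodType) (w : obA -> V) i :
  (forall j, i <> j -> w j = 0) -> sum4 w = w i.
Proof.
rewrite /sum4; case: i => w0.
- by rewrite (w0 a2) // (w0 a3) // (w0 a4) // !addr0.
- by rewrite (w0 a1) // (w0 a3) // (w0 a4) // !addr0 add0r.
- by rewrite (w0 a1) // (w0 a2) // (w0 a4) // addr0 !add0r.
- by rewrite (w0 a1) // (w0 a2) // (w0 a3) // !add0r.
Qed.

Lemma linear_sum4 (U V : lmodType R) (f : {linear U -> V}) (w : obA -> U) :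
  f (sum4 w) = sum4 (fun j => f (w j)).
Proof. by rewrite /sum4 !linearD. Qed.

Lemma eq_sum4 (V : nmodType) (v w : obA -> V) : v =1 w -> sum4 v = sum4 w.
Proof. by move=> e; rewrite /sum4 !e. Qed.

Lemma sum4_pair (U V : nmodType) (v : obA -> U) (w : obA -> V) :
  (sum4 v, sum4 w) = sum4 (fun j => (v j, w j)).
Proof. by []. Qed.

(** The retracts of the sums of standard modules on projective R-modules, with
    the two maps given by their components. Retracts are used because they
    pass to direct summands for free. *)
Definition std_retract M : Prop :=
  exists (V : obA -> lmodType R) (al : forall j, rcHom M (std j (V j)))
         (be : forall j, rcHom (std j (V j)) M),
    (forall j, lmod_fgproj (V j)) /\
    (forall (i : obA) (m : M i), sum4 (fun j => be j i (al j i m)) = m).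

Lemma std_retract_retract M N (f : rcHom M N) (g : rcHom N M) :
  (forall (i : obA) m, g i (f i m) = m) -> std_retract N -> std_retract M.
Proof.
move=> gf [V [al [be [hV e]]]].
exists V, (fun j => hcomp (al j) f), (fun j => hcomp g (be j)); split=> // i m.
by rewrite -[RHS]gf -[in RHS](e i (f i m)) linear_sum4.
Qed.

Lemma std_retract_isom M N : rc_isom M N -> std_retract N -> std_retract M.
Proof.
case/rc_isomP => f [g fg]; apply: (std_retract_retract (f := f) (g := g)) => i m.
by have [fK _] := fg i.
Qed.

Lemma std_retract_zero : std_retract (rc_zero R AAcat).
Proof.
exists (fun=> 'rV[R]_0), (fun=> hzero _ _), (fun=> hzero _ _); split=> [_|i m].
  by apply: fgfree_fgproj; exists 0%N; apply: lmod_isom_refl.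
exact: etrans (thinmx0 _) (esym (thinmx0 m)).
Qed.

Lemma std_map0 j Q Q' (f : {linear Q -> Q'}) : (forall q, f q = 0) ->
  forall (i : obA) m, std_map j f i m = 0.
Proof.
move=> f0 i m; apply: (addIr (std_map j f i m)); rewrite add0r.
by rewrite -(std_mapD (f := f) (g := f) (h := f)) // => q; rewrite !f0 addr0.
Qed.

Lemma std_split j A B D : lsplit A B D -> @rc_split R AAcat (std j A) (std j B) (std j D).
Proof.
case=> i [p] [r] [s] [ir sp e].
exists (std_map j i), (std_map j p), (std_map j r), (std_map j s); split=> x m.
- rewrite -(std_map_comp (f := i) (g := r) (h := idfun)) ?std_map_id //.
- rewrite -(std_map_comp (f := s) (g := p) (h := idfun)) ?std_map_id //.
- rewrite -(std_map_comp (f := r) (g := i) (h := i \o r)) //.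
  rewrite -(std_map_comp (f := p) (g := s) (h := s \o p)) //.
  by rewrite -(std_mapD (h := idfun)) ?std_map_id // => q; rewrite /= e.
Qed.

Lemma std_retract_dsum M N : std_retract M -> std_retract N -> std_retract (rc_dsum M N).
Proof.
move=> [V [al [be [hV e]]]] [V' [al' [be' [hV' e']]]].
exists (fun j => (V j * V' j)%type).
exists (fun j => hcase (hcomp (std_map j (linl (V j) (V' j))) (al j))
                       (hcomp (std_map j (linr (V j) (V' j))) (al' j))).
exists (fun j => hpair (hcomp (be j) (std_map j (lfst (V j) (V' j))))
                       (hcomp (be' j) (std_map j (lsnd (V j) (V' j))))).
split=> [j|i [m n]]; first exact: fgproj_prod.
rewrite -sum4_pair; congr pair.
  rewrite -[RHS]e; apply: eq_sum4 => j; rewrite /= linearD.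
  rewrite -(std_map_comp (h := idfun)) // std_map_id //.
  by rewrite -(std_map_comp (h := \0)) // std_map0 // addr0.
rewrite -[RHS]e'; apply: eq_sum4 => j; rewrite /= linearD.
rewrite -(std_map_comp (h := \0)) // std_map0 // add0r.
by rewrite -(std_map_comp (h := idfun)) // std_map_id.
Qed.

(** ** Splitting off the heads *)

Definition std_sum (W : obA -> lmodType R) : rcMod R AAcat :=
  rc_dsum (rc_dsum (rc_dsum (std a1 (W a1)) (std a2 (W a2))) (std a3 (W a3)))
          (std a4 (W a4)).

Definition std_in (W : obA -> lmodType R) (j : obA) : rcHom (std j (W j)) (std_sum W) :=
  match j return rcHom (std j (W j)) (std_sum W) with
  | a1 => hcomp (hinl _ _) (hcomp (hinl _ _) (hinl _ _))
  | a2 => hcomp (hinl _ _) (hcomp (hinl _ _) (hinr _ _))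
  | a3 => hcomp (hinl _ _) (hinr _ _)
  | a4 => hinr _ _
  end.

Definition std_proj (W : obA -> lmodType R) (j : obA) : rcHom (std_sum W) (std j (W j)) :=
  match j return rcHom (std_sum W) (std j (W j)) with
  | a1 => hcomp (hfst _ _) (hcomp (hfst _ _) (hfst _ _))
  | a2 => hcomp (hsnd _ _) (hcomp (hfst _ _) (hfst _ _))
  | a3 => hcomp (hsnd _ _) (hfst _ _)
  | a4 => hsnd _ _
  end.

Lemma std_in_proj W (i : obA) (x : std_sum W i) :
  sum4 (fun j => std_in W j i (std_proj W j i x)) = x.
Proof.
case: x => [[[x1 x2] x3] x4]; rewrite /sum4 /=.
by do ![congr pair]; rewrite /= ?addr0 ?add0r.
Qed.

Definition std_tuple M (W : obA -> lmodType R) (f : forall j, rcHom M (std j (W j))) :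
    rcHom M (std_sum W) :=
  hpair (hpair (hpair (f a1) (f a2)) (f a3)) (f a4).

Lemma std_tupleE M W (f : forall j, rcHom M (std j (W j))) j (i : obA) m :
  std_proj W j i (std_tuple f i m) = f j i m.
Proof. by case: j. Qed.

Definition std_cotuple M (W : obA -> lmodType R) (g : forall j, rcHom (std j (W j)) M) :
    rcHom (std_sum W) M :=
  hcase (hcase (hcase (g a1) (g a2)) (g a3)) (g a4).

(** Given a retraction of the sum of the [std j (V j)] onto M, only its j-th
    component matters on the j-th head, since the other standard modules
    are radical at j. Hence the j-th head of M is a retract of [V j]. The maps
    that this retract induces between M and the sum of the
    [std j (head j M)] are mutually inverse on heads. *)
Section SplitHeads.
Variables (M : rcMod R AAcat) (V : obA -> lmodType R).
Variables (al : forall j, rcHom M (std j (V j))) (be : forall j, rcHom (std j (V j)) M).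
Hypothesis e : forall (i : obA) (m : M i), sum4 (fun j => be j i (al j i m)) = m.

Lemma hd_be i j n : i <> j -> hd i M (be j i n) = 0.
Proof. by move=> ij; apply/hd0P/in_rad_nat/(std_in_rad (j := j)). Qed.

Lemma hd_sum i (w : forall j, std j (V j) i) :
  hd i M (sum4 (fun j => be j i (w j))) = hd i M (be i i (w i)).
Proof.
by rewrite linear_sum4; apply: (sum4_only (i := i)) => j; apply: hd_be.
Qed.

Lemma head_retract_ex j :
  exists (h : {linear V j -> head j M}) (k : {linear head j M -> V j}),
  [/\ cancel k h, forall v, hd j M (be j j (std_gen j (V j) v)) = h v
    & forall m, al j j m = std_gen j (V j) (k (hd j M m))].
Proof.
have [d [genK dK]] := std_gen_bij j (V j).
have [m rm|k kE] := @hd_lift R j M (V j) (d \o al j j).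
  by rewrite /= (std_rad0 (in_rad_nat (al j) rm)) linear0.
pose h : {linear V j -> head j M} := hd j M \o be j j \o std_gen j (V j).
exists h, k; split=> [x|//|m]; last by rewrite kE /= dK.
have [m <-] := hd_surj x; rewrite kE /= dK.
by rewrite -(hd_sum (fun l => al l j m)) e.
Qed.

Lemma std_decomposition_of_retract : (forall j, lmod_fgproj (V j)) ->
  (forall j, lmod_fgproj (head j M)) /\ rc_isom M (std_sum (fun j => head j M)).
Proof.
move=> hV.
have hkP j := cid (head_retract_ex j).
pose h j := sval (hkP j); have kP j := cid (svalP (hkP j)).
pose k j := sval (kP j).
have kh j : cancel (k j) (h j) by rewrite /k /h; case: (kP j) => k' [].
have be_h j v : hd j M (be j j (std_gen j (V j) v)) = h j v.
  by rewrite /h; case: (kP j) => k' [].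
have al_k j m : al j j m = std_gen j (V j) (k j (hd j M m)).
  by rewrite /k; case: (kP j) => k' [].
split=> [j|]; first by apply: fgproj_retract (kh j) (hV j).
pose f : rcHom M (std_sum (fun j => head j M)) :=
  std_tuple (fun j => hcomp (std_map j (h j)) (al j)).
pose g : rcHom (std_sum (fun j => head j M)) M :=
  std_cotuple (fun j => hcomp (be j) (std_map j (k j))).
pose W j := head j M.
have fE (i : obA) m j : std_proj W j i (f i m) = std_map j (h j) i (al j i m).
  exact: std_tupleE.
have gE (i : obA) x :
    g i x = sum4 (fun j => be j i (std_map j (k j) i (std_proj W j i x))) by [].
have hd_in (i : obA) (x : std_sum W i) :
    hd i (std_sum W) x = hd i _ (std_in W i i (std_proj W i i x)).
  rewrite -[in LHS](std_in_proj x) linear_sum4; apply: (sum4_only (i := i)) => j ij.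
  exact/hd0P/in_rad_nat/(std_in_rad (j := j)).
apply: (head_inverse_isom (f := f) (g := g)) => i m.
  rewrite gE (hd_sum (fun j => std_map j (k j) i (std_proj W j i (f i m)))) fE.
  by rewrite al_k !std_map_gen be_h !kh.
rewrite hd_in [RHS]hd_in; congr (hd i _ (std_in W i i _)); rewrite fE al_k gE.
rewrite (hd_sum (fun j => std_map j (k j) i (std_proj W j i m))).
have [d [genK dK]] := std_gen_bij i (W i).
by rewrite -(dK (std_proj W i i m)) !std_map_gen be_h !kh.
Qed.

End SplitHeads.

End Decomposition.
(** * Representable modules and the standard modules *)

Section Representables.
Variable R : comNzRingType.
Implicit Types (M N L : rcMod R AAcat) (Q V : lmodType R).

(** Since K_1(R) is represented by the summand of a1 cut out by id - f11, a map
    from K_1(Q) to M is a linear map from Q to the kernel of f31 in the value of M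
    at a1. The module K_2(Q) is treated in the same way. *)
Section Lift1.
Variables (Q : lmodType R) (M : rcMod R AAcat) (s : {linear Q -> M a1}).
Hypothesis s0 : forall q, rc_act M (f31 : mor (a3 : AAcat) a1) (s q) = 0.

Definition K1_lift_comp (x : obA) : {linear Kval Q x -> M x} :=
  match x return {linear Kval Q x -> M x} with
  | a1 => s
  | a2 => rc_act M (g21 : mor (a2 : AAcat) a1) \o s
  | _ => \0
  end.

Lemma K1_lift_nat (x y : obA) (u : morA x y) m :
  K1_lift_comp x (Kact Q true u m) = rc_act M (u : mor (x : AAcat) y) (K1_lift_comp y m).
Proof.
have act_f_s (k : obA) q (u' : mor (k : AAcat) a1) (v : mor (k : AAcat) a3) :
    compA (f31 : mor (a3 : AAcat) a1) v = u' -> rc_act M u' (s q) = 0.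
  by move=> <-; rewrite [LHS]rc_actM s0 linear0.
have act_f_gs (k : obA) q (u' : mor (k : AAcat) a2) (v : mor (k : AAcat) a3) :
    compA g21 u' = compA f31 v -> rc_act M u' (rc_act M (g21 : mor (a2 : AAcat) a1) (s q)) = 0.
  by move=> e; rewrite -rc_actM; exact: act_f_s (esym e).
(* All arrows but id1, id2 and g21 act on the image of K_1(Q) through f31. *)
case: x y / u m => m; rewrite /= ?linear0 ?rc_act1 //; apply/esym;
  first [exact: (act_f_s _ _ _ f13) | exact: (act_f_s _ _ _ f23) | exact: (act_f_s _ _ _ f33)
        | exact: (act_f_gs _ _ _ f13) | exact: (act_f_gs _ _ _ f23) | exact: (act_f_gs _ _ _ f33)
        | exact: (@rc_act1 _ _ M a1) | exact: (@rc_act1 _ _ M a2)].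
Qed.

Definition K1_lift : rcHom (K1 Q) M :=
  @RCHom R AAcat (K1 Q) M K1_lift_comp K1_lift_nat.

End Lift1.

Section Lift2.
Variables (Q : lmodType R) (M : rcMod R AAcat) (s : {linear Q -> M a2}).
Hypothesis s0 : forall q, rc_act M (f32 : mor (a3 : AAcat) a2) (s q) = 0.

Definition K2_lift_comp (x : obA) : {linear Kval Q x -> M x} :=
  match x return {linear Kval Q x -> M x} with
  | a1 => rc_act M (g12 : mor (a1 : AAcat) a2) \o s
  | a2 => s
  | _ => \0
  end.

Lemma K2_lift_nat (x y : obA) (u : morA x y) m :
  K2_lift_comp x (Kact Q false u m) = rc_act M (u : mor (x : AAcat) y) (K2_lift_comp y m).
Proof.
have act_f_s (k : obA) q (u' : mor (k : AAcat) a2) (v : mor (k : AAcat) a3) :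
    compA (f32 : mor (a3 : AAcat) a2) v = u' -> rc_act M u' (s q) = 0.
  by move=> <-; rewrite [LHS]rc_actM s0 linear0.
have act_f_gs (k : obA) q (u' : mor (k : AAcat) a1) (v : mor (k : AAcat) a3) :
    compA g12 u' = compA f32 v -> rc_act M u' (rc_act M (g12 : mor (a1 : AAcat) a2) (s q)) = 0.
  by move=> e; rewrite -rc_actM; exact: act_f_s (esym e).
(* All arrows but id1, id2 and g12 act on the image of K_2(Q) through f32. *)
case: x y / u m => m; rewrite /= ?linear0 ?rc_act1 //; apply/esym;
  first [exact: (act_f_s _ _ _ f13) | exact: (act_f_s _ _ _ f23) | exact: (act_f_s _ _ _ f33)
        | exact: (act_f_gs _ _ _ f13) | exact: (act_f_gs _ _ _ f23) | exact: (act_f_gs _ _ _ f33)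
        | exact: (@rc_act1 _ _ M a1) | exact: (@rc_act1 _ _ M a2)].
Qed.

Definition K2_lift : rcHom (K2 Q) M :=
  @RCHom R AAcat (K2 Q) M K2_lift_comp K2_lift_nat.

End Lift2.

(** The idempotent f11 = f31 o f13 splits off a copy of a3, and the complement
    is the copy of K_1(R) generated by id - f11. *)
Lemma Rmor1_split : @rc_split R AAcat (std a1 R^o) (Rmor R (a1 : AAcat)) (Rmor R (a3 : AAcat)).
Proof.
pose e : Rmor R (a1 : AAcat) a1 := << id1 >> - << f11 >>.
pose s := mkLin (scale_linear e).
have s0 q : rc_act (Rmor R (a1 : AAcat)) (f31 : mor (a3 : AAcat) a1) (s q) = 0.
  by rewrite linearZ_LR linearB !Rmor_actE subrr scaler0.
pose p := yo (<< f13 >> : Rmor R (a3 : AAcat) a1).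
pose r := @yo R AAcat (K1 R^o) a1 (1 : R^o).
pose t := yo (<< f31 >> : Rmor R (a1 : AAcat) a3).
exists (K1_lift s0), p, r, t; split.
- have re : r a1 e = 1 by rewrite linearB !yoE /= subr0.
  have rg : r a2 (rc_act (Rmor R (a1 : AAcat)) (g21 : mor (a2 : AAcat) a1) e) = 1.
    by rewrite rc_nat re.
  case=> m.
  + by rewrite [LHS]linearZ_LR re [LHS]mulr1.
  + by rewrite /= 2!linearZ_LR rg [LHS]mulr1.
  + exact: etrans (thinmx0 _) (esym (thinmx0 _)).
  + exact: etrans (thinmx0 _) (esym (thinmx0 _)).
- move=> x m; apply: (Rmor_hom_ext (f := hcomp p t) (g := hid _)).
  rewrite [LHS](congr1 (p a3) (yoE (<< f31 >> : Rmor R (a1 : AAcat) a3) (idm _))) rc_act1.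
  by rewrite yoE Rmor_actE.
- move=> x m; apply: (Rmor_hom_ext (f := hadd (hcomp (K1_lift s0) r) (hcomp t p)) (g := hid _)).
  have r1 : r a1 << idm (a1 : AAcat) >> = 1 by rewrite yoE rc_act1.
  have p1 : p a1 << idm (a1 : AAcat) >> = << f13 >> by rewrite yoE rc_act1.
  rewrite [LHS](congr2 (fun u v => K1_lift s0 a1 u + t a1 v) r1 p1) yoE Rmor_actE /=.
  by rewrite scale1r subrK.
Qed.

(** The same for the idempotent f22 = f32 o f23. *)
Lemma Rmor2_split : @rc_split R AAcat (std a2 R^o) (Rmor R (a2 : AAcat)) (Rmor R (a3 : AAcat)).
Proof.
pose e : Rmor R (a2 : AAcat) a2 := << id2 >> - << f22 >>.
pose s := mkLin (scale_linear e).
have s0 q : rc_act (Rmor R (a2 : AAcat)) (f32 : mor (a3 : AAcat) a2) (s q) = 0.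
  by rewrite linearZ_LR linearB !Rmor_actE subrr scaler0.
pose p := yo (<< f23 >> : Rmor R (a3 : AAcat) a2).
pose r := @yo R AAcat (K2 R^o) a2 (1 : R^o).
pose t := yo (<< f32 >> : Rmor R (a2 : AAcat) a3).
exists (K2_lift s0), p, r, t; split.
- have re : r a2 e = 1 by rewrite linearB !yoE /= subr0.
  have rg : r a1 (rc_act (Rmor R (a2 : AAcat)) (g12 : mor (a1 : AAcat) a2) e) = 1.
    by rewrite rc_nat re.
  case=> m.
  + by rewrite /= 2!linearZ_LR rg [LHS]mulr1.
  + by rewrite [LHS]linearZ_LR re [LHS]mulr1.
  + exact: etrans (thinmx0 _) (esym (thinmx0 _)).
  + exact: etrans (thinmx0 _) (esym (thinmx0 _)).
- move=> x m; apply: (Rmor_hom_ext (f := hcomp p t) (g := hid _)).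
  rewrite [LHS](congr1 (p a3) (yoE (<< f32 >> : Rmor R (a2 : AAcat) a3) (idm _))) rc_act1.
  by rewrite yoE Rmor_actE.
- move=> x m; apply: (Rmor_hom_ext (f := hadd (hcomp (K2_lift s0) r) (hcomp t p)) (g := hid _)).
  have r1 : r a2 << idm (a2 : AAcat) >> = 1 by rewrite yoE rc_act1.
  have p1 : p a2 << idm (a2 : AAcat) >> = << f23 >> by rewrite yoE rc_act1.
  rewrite [LHS](congr2 (fun u v => K2_lift s0 a2 u + t a2 v) r1 p1) yoE Rmor_actE /=.
  by rewrite scale1r subrK.
Qed.

Lemma std_zero j Q : (forall q : Q, q = 0) -> forall (i : obA) (m : std j Q i), m = 0.
Proof.
move=> Q0 i m; rewrite -[LHS](std_map_id (j := j) (f := idfun)) //.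
by apply: std_map0 => q; rewrite [q]Q0.
Qed.

Lemma std_Ro_isom j : isA3 j || isA4 j -> rc_isom (std j R^o) (Rmor R (j : AAcat)).
Proof. by case: j => // _; apply: ext_Rmor. Qed.

Lemma std_Ro_fgproj j : rc_fgproj (std j R^o).
Proof.
have summand k D : @rc_split R AAcat (std j R^o) (Rmor R (k : AAcat)) D -> rc_fgproj (std j R^o).
  move=> /rc_split_isom h; apply: (@rc_fgproj_summand _ _ _ D).
  exact/rc_fgfree_fgproj/(rc_fgfree_isom (rc_isom_sym h))/Rmor_fgfree.
have free : isA3 j || isA4 j -> rc_fgproj (std j R^o).
  move=> /std_Ro_isom h.
  exact/rc_fgfree_fgproj/(rc_fgfree_isom h)/Rmor_fgfree.
case: j summand free => summand free; do ?exact: free.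
  exact: summand Rmor1_split.
exact: summand Rmor2_split.
Qed.

Lemma std_isom j (A B : lmodType R) : lmod_isom A B -> rc_isom (std j A) (std j B).
Proof.
case=> f /bij_linear_inv[g [fg gf]]; exists (std_map j f) => i.
exists (std_map j g i) => m.
  by rewrite -(std_map_comp (h := idfun)) ?std_map_id.
by rewrite -(std_map_comp (h := idfun)) ?std_map_id.
Qed.

(** [std j] is additive and takes R to a projective module, so it takes R^n,
    and then direct summands of R^n, to projective modules. *)
Lemma std_fgproj j Q : lmod_fgproj Q -> rc_fgproj (std j Q).
Proof.
have rV_fgproj n : rc_fgproj (std j 'rV[R]_n).
  elim: n => [|n IH].
    apply: rc_fgproj_isom (rc_fgfree_fgproj (bigsum_fgfree R [::])).
    exists (hzero _ _) => i; exists (fun=> 0) => m; last exact: esym (thinmx0 _).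
    by apply/esym/std_zero => q; apply: thinmx0.
  have h : lmod_isom 'rV[R]_n.+1 (R^o * 'rV[R]_n)%type.
    apply: lmod_isom_sym (lmod_isom_trans _ (rV_prod R 1 n)).
    exact: lmod_isom_prod (Ro_rV1 R) (lmod_isom_refl _).
  apply: rc_fgproj_isom (std_isom _ h) _.
  apply: rc_fgproj_isom (rc_split_isom (std_split j (lsplit_prod _ _))) _.
  exact: rc_fgproj_dsum (std_Ro_fgproj j) IH.
case=> N [n /(std_isom j) h]; apply: (@rc_fgproj_summand _ _ _ (std j N)).
apply: rc_fgproj_isom (rV_fgproj n); apply: rc_isom_trans h.
exact: rc_isom_sym (rc_split_isom (std_split j (lsplit_prod _ _))).
Qed.

Definition std_delta Q j k : rcHom (std j Q) (std k Q) :=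
  match j, k return rcHom (std j Q) (std k Q) with
  | a1, a1 | a2, a2 | a3, a3 | a4, a4 => hid _
  | _, _ => hzero _ _
  end.

Lemma std_delta_diag Q j (i : obA) m : std_delta Q j j i m = m.
Proof. by case: j m. Qed.

Lemma std_delta_off Q j k (i : obA) m : j <> k -> std_delta Q j k i m = 0.
Proof. by case: j m => m; case: k. Qed.

Lemma std_retract_std j Q : lmod_fgproj Q -> std_retract (std j Q).
Proof.
move=> hQ; exists (fun=> Q), (std_delta Q j), (fun k => std_delta Q k j).
split=> // i m; rewrite (sum4_only (i := j)) => [|k jk].
  by rewrite !std_delta_diag.
by rewrite (std_delta_off _ jk) linear0.
Qed.

Lemma Rmor_std_retract (x : AAcat) : std_retract (Rmor R x).
Proof.
have Ro j : std_retract (std j R^o).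
  exact/std_retract_std/fgfree_fgproj/Ro_fgfree.
have r3 : std_retract (Rmor R (a3 : AAcat)).
  exact: std_retract_isom (rc_isom_sym (ext_Rmor R (_ : AAcat))) (Ro a3).
case: x.
- exact: std_retract_isom (rc_split_isom Rmor1_split) (std_retract_dsum (Ro a1) r3).
- exact: std_retract_isom (rc_split_isom Rmor2_split) (std_retract_dsum (Ro a2) r3).
- exact: r3.
- exact: std_retract_isom (rc_isom_sym (ext_Rmor R (_ : AAcat))) (Ro a4).
Qed.

Lemma fgproj_std_retract M : rc_fgproj M -> std_retract M.
Proof.
case=> N [s /rc_isomP[f [g fg]]].
have hs : std_retract (rc_bigsum [seq Rmor R x | x <- s]).
  elim: s {f g fg} => [|x s IH]; first exact: std_retract_zero.
  exact: std_retract_dsum (Rmor_std_retract x) IH.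
apply: (std_retract_retract (f := hcomp f (hinl M N)) (g := hcomp (hfst M N) g) _ hs).
by move=> i m; have [fK _] := fg i; rewrite /= fK.
Qed.

Theorem std_decomposition M : rc_fgproj M ->
  (forall j, lmod_fgproj (head j M)) /\ rc_isom M (std_sum (fun j => head j M)).
Proof.
by case/fgproj_std_retract => V [al [be [hV e]]]; apply: std_decomposition_of_retract e hV.
Qed.

Lemma head_std_diag j Q : lmod_isom (head j (std j Q)) Q.
Proof.
apply: lmod_isom_sym; exists (hd j (std j Q) \o std_gen j Q).
have [d [genK dK]] := std_gen_bij j Q.
have [m rm|d' d'E] := @hd_lift R j _ Q d; first by rewrite (std_rad0 rm) linear0.
exists d' => [q|x]; first by rewrite /= d'E genK.
by have [m <-] := hd_surj x; rewrite /= d'E dK.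
Qed.

Lemma head_std_off i j Q : i <> j -> forall x : head i (std j Q), x = 0.
Proof.
move=> ij x; have [m <-] := hd_surj x; exact/hd0P/std_in_rad.
Qed.

End Representables.
(** * Classes in the Grothendieck groups *)

Section Classes.
Variable R : comNzRingType.
Local Open Scope ag_scope.

Lemma K0_isom (P Q : fgprojMod R) : lmod_isom P Q -> K0cls P = K0cls Q.
Proof. by move=> h; exact: (@groth_gen_iso (fgprojMod R) _ _ P Q h). Qed.

Lemma K0_split (A B D : fgprojMod R) : lsplit A B D -> K0cls B = K0cls A + K0cls D.
Proof. by move=> /lsplit_ses h; exact: (@groth_gen_ses (fgprojMod R) _ _ A B D h). Qed.

Lemma K0_zero (P : fgprojMod R) : (forall m : P, m = 0%R) -> K0cls P = ag0.
Proof.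
move=> P0; apply/idem_ag0/K0_split.
exists idfun, idfun, idfun, idfun; split=> // m.
by rewrite [LHS]P0 [RHS]P0.
Qed.

Lemma K0rc_isom (P Q : fgprojRC R AAcat) : rc_isom P Q -> K0rc_cls P = K0rc_cls Q.
Proof. by move=> h; exact: (@groth_gen_iso (fgprojRC R AAcat) _ _ P Q h). Qed.

Lemma K0rc_split (A B D : fgprojRC R AAcat) :
  rc_split A B D -> K0rc_cls B = K0rc_cls A + K0rc_cls D.
Proof. by move=> /rc_split_ses h; exact: (@groth_gen_ses (fgprojRC R AAcat) _ _ A B D h). Qed.

Definition stdP (j : obA) (P : fgprojMod R) : fgprojRC R AAcat :=
  FgprojRC (std_fgproj j (fgpm_prop P)).

Definition headP (j : obA) (M : fgprojRC R AAcat) : fgprojMod R :=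
  FgprojMod ((std_decomposition (fgprc_prop M)).1 j).

Lemma xi_comp_ex j : exists f : K0 R -> K0rc R AAcat,
  ag_hom f /\ forall P, f (K0cls P) = K0rc_cls (stdP j P).
Proof.
apply: groth_lift => [A B h|A B D h]; first exact/K0rc_isom/std_isom.
exact/K0rc_split/std_split/(fgproj_ses_lsplit (fgpm_prop D)).
Qed.

Lemma eta_comp_ex j : exists f : K0rc R AAcat -> K0 R,
  ag_hom f /\ forall M, f (K0rc_cls M) = K0cls (headP j M).
Proof.
apply: groth_lift => [A B h|A B D h]; first exact/K0_isom/head_isom.
exact/K0_split/head_split/(fgproj_ses_rc_split (fgprc_prop D)).
Qed.

Lemma eta_xi_diag j (f : K0 R -> K0rc R AAcat) (g : K0rc R AAcat -> K0 R) :
  ag_hom f -> (forall P, f (K0cls P) = K0rc_cls (stdP j P)) ->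
  ag_hom g -> (forall M, g (K0rc_cls M) = K0cls (headP j M)) ->
  forall x, g (f x) = x.
Proof.
move=> hf fE hg gE; apply: (pres_hom_ext (f := g \o f) (g := id)) => [|//|P].
  exact: ag_hom_comp.
by rewrite /= [f _]fE gE; apply/K0_isom/head_std_diag.
Qed.

Lemma eta_xi_off i j (f : K0 R -> K0rc R AAcat) (g : K0rc R AAcat -> K0 R) :
  ag_hom f -> (forall P, f (K0cls P) = K0rc_cls (stdP j P)) ->
  ag_hom g -> (forall M, g (K0rc_cls M) = K0cls (headP i M)) ->
  i <> j -> forall x, g (f x) = ag0.
Proof.
move=> hf fE hg gE ij; apply: (pres_hom_ext (f := g \o f) (g := fun=> ag0)) => [|x y|P].
- exact: ag_hom_comp.
- by rewrite ag0D.
- by rewrite /= [f _]fE gE; apply/K0_zero => m; apply: head_std_off.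
Qed.

Lemma K0rc_decomposition (M : fgprojRC R AAcat) :
  K0rc_cls M = ag_sum4 (fun j => K0rc_cls (stdP j (headP j M))).
Proof.
have [_ iso] := std_decomposition (fgprc_prop M).
pose S j := stdP j (headP j M).
pose D (A B : fgprojRC R AAcat) : fgprojRC R AAcat :=
  FgprojRC (rc_fgproj_dsum (fgprc_prop A) (fgprc_prop B)).
have DE A B : K0rc_cls (D A B) = K0rc_cls A + K0rc_cls B.
  exact/K0rc_split/rc_split_dsum.
rewrite (@K0rc_isom M (D (D (D (S a1) (S a2)) (S a3)) (S a4))) //.
by rewrite !DE.
Qed.

End Classes.

(** * Ranks of heads *)

Section HeadRanks.
Variable R : comNzRingType.

Lemma head_zero i (M : rcMod R AAcat) : (forall (x : obA) (m : M x), m = 0) ->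
  forall z : head i M, z = 0.
Proof. by move=> M0 z; have [m <-] := hd_surj z; rewrite [m]M0 linear0. Qed.

(** The Kronecker delta. *)
Definition std_rank (i j : obA) : nat :=
  match i, j with
  | a1, a1 | a2, a2 | a3, a3 | a4, a4 => 1
  | _, _ => 0
  end.

Lemma head_std_rank i j : lmod_isom (head i (std j (R^o : lmodType R))) 'rV[R]_(std_rank i j).
Proof.
have diag : lmod_isom (head j (std j (R^o : lmodType R))) 'rV[R]_1.
  exact: lmod_isom_trans (head_std_diag j _) (Ro_rV1 R).
have off : i <> j -> lmod_isom (head i (std j (R^o : lmodType R))) 'rV[R]_0.
  by move=> ij; apply/lmod_zero_isom/head_std_off.
by case: i j diag off => -[] diag off; first [exact: diag | exact: off].
Qed.

Definition Rmor_rank (i x : obA) : nat :=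
  match x with
  | a1 => std_rank i a1 + std_rank i a3
  | a2 => std_rank i a2 + std_rank i a3
  | _ => std_rank i x
  end.

Lemma head_Rmor_rank i (x : obA) :
  lmod_isom (head i (Rmor R (x : AAcat))) 'rV[R]_(Rmor_rank i x).
Proof.
have ext (y : AAcat) n : lmod_isom (head i (extE y (R^o : lmodType R))) 'rV[R]_n ->
    lmod_isom (head i (Rmor R y)) 'rV[R]_n.
  by apply: lmod_isom_trans; apply/head_isom/rc_isom_sym/ext_Rmor.
have i3 := ext (a3 : AAcat) _ (head_std_rank i a3).
case: x; [| |exact: i3|exact: ext (head_std_rank i a4)].
  have := lsplit_isom (head_split i (Rmor1_split R)); move/lmod_isom_trans; apply.
  apply: lmod_isom_trans (rV_prod _ _ _).
  exact: lmod_isom_prod (head_std_rank i a1) i3.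
have := lsplit_isom (head_split i (Rmor2_split R)); move/lmod_isom_trans; apply.
apply: lmod_isom_trans (rV_prod _ _ _).
exact: lmod_isom_prod (head_std_rank i a2) i3.
Qed.

Lemma head_fgfree i (M : rcMod R AAcat) : rc_fgfree M -> lmod_fgfree (head i M).
Proof.
case=> s /(head_isom i) h; apply: (fgfree_isom h); elim: s {M h} => [|x s IH].
  by exists 0%N; apply/lmod_zero_isom/head_zero => y; apply: rc_zero0.
have hx : lmod_fgfree (head i (Rmor R x)) by exists (Rmor_rank i x); apply: head_Rmor_rank.
by have [] := fgfree_lsplit hx IH (head_split i (rc_split_dsum _ _)).
Qed.

(** The i-th head counts the summands R mor(?,a_i) of a free module, except
    that the third head also counts the first two kinds of summands. The
    weights undo this. *)
Variables (G : abGroup) (u : obA -> G).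
Local Open Scope ag_scope.

Definition head_weight (i : obA) : G :=
  match i with
  | a1 => u a1 + agN (u a3) | a2 => u a2 + agN (u a3)
  | a3 => u a3 | a4 => u a4
  end.

Definition rank_class (M : rcMod R AAcat) : G :=
  ag_sum4 (fun i => ag_muln (head_weight i) (lrank (head i M))).

Lemma rank_class_isom M N : (forall i, lmod_fgfree (head i N)) ->
  rc_isom M N -> rank_class M = rank_class N.
Proof.
move=> hN h; rewrite /rank_class /ag_sum4.
by rewrite !(lrank_isom (hN _) (head_isom _ h)).
Qed.

Lemma rank_class_split A B D : (forall i, lmod_fgfree (head i A)) ->
  (forall i, lmod_fgfree (head i D)) -> rc_split A B D ->
  rank_class B = rank_class A + rank_class D.
Proof.
move=> hA hD h; rewrite -ag_sum4D /rank_class; congr ag_sum4; apply: funext => i.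
have [_ ->] := fgfree_lsplit (hA i) (hD i) (head_split i h).
exact: ag_mulnD.
Qed.

Lemma rank_class_Rmor (x : obA) : rank_class (Rmor R (x : AAcat)) = u x.
Proof.
rewrite /rank_class /ag_sum4 !(lrankE (head_Rmor_rank _ x)).
case: x => /=; rewrite ?agD0 ?ag0D //.
  by rewrite -agDA agND agD0.
by rewrite -agDA agND agD0.
Qed.

End HeadRanks.

Section FreeClasses.
Variable R : comNzRingType.
Local Open Scope ag_scope.

Lemma K0f_isom (P Q : fgfreeRC R AAcat) : rc_isom P Q -> K0f_cls P = K0f_cls Q.
Proof. by move=> h; exact: (@groth_gen_iso (fgfreeRC R AAcat) _ _ P Q h). Qed.

Lemma K0f_split (A B D : fgfreeRC R AAcat) :
  rc_split A B D -> K0f_cls B = K0f_cls A + K0f_cls D.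
Proof. by move=> /rc_split_ses h; exact: (@groth_gen_ses (fgfreeRC R AAcat) _ _ A B D h). Qed.

Definition RmorF (x : AAcat) : fgfreeRC R AAcat := FgfreeRC (Rmor_fgfree R x).

(** Out of an object other than a3, a composite of two arrows of which the
    first is not an identity is never an identity. So an isomorphism that is
    not an identity could only go from a3 to itself. *)
Lemma AA_isom_eq (x y : AAcat) : ob_isom x y -> x = y.
Proof.
case=> u [v [vu uv]].
have id_eq (x' y' : obA) (w : morA x' y') : is_idA w -> x' = y' by case: x' y' / w.
have id_comp (x' y' z : obA) (w : morA x' y') (w' : morA y' z) :
    is_idA (compA w' w) -> is_idA w || isA3 x'.
  case: x' y' / w w' => // w'; do ?by case: z w'.
  - by move: z w'; apply: morA_from2 => [|||[]].
  - by move: z w'; apply: morA_from1 => [||[]].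
  - by move: z w'; apply: morA_from4.
have /orP[/id_eq//|x3] : is_idA (u : morA x y) || isA3 x.
  by apply: (id_comp _ _ _ _ (v : morA y x)); rewrite [compA _ _]vu; case: (x).
have /orP[/id_eq//|y3] : is_idA (v : morA y x) || isA3 y.
  by apply: (id_comp _ _ _ _ (u : morA x y)); rewrite [compA _ _]uv; case: (y).
by case: (x) x3 => //; case: (y) y3.
Qed.

End FreeClasses.
(** * The comparison isomorphisms *)

Section GrothendieckIsomorphisms.
Variable R : comNzRingType.
Local Open Scope ag_scope.

Lemma xi_eta_inverse :
  exists (xi : agpow4 (K0 R) -> K0rc R AAcat) (eta : K0rc R AAcat -> agpow4 (K0 R)),
    [/\ ag_hom xi /\ ag_hom eta,
        forall P1 P2 P3 P4 : fgprojMod R,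
          xi (K0cls P1, K0cls P2, K0cls P3, K0cls P4) =
            K0rc_cls (stdP a1 P1) + K0rc_cls (stdP a2 P2)
            + K0rc_cls (stdP a3 P3) + K0rc_cls (stdP a4 P4),
        forall P : fgprojRC R AAcat,
          eta (K0rc_cls P) =
            (K0cls (headP a1 P), K0cls (headP a2 P), K0cls (headP a3 P), K0cls (headP a4 P)),
        cancel xi eta
      & cancel eta xi].
Proof.
pose xc j := sval (cid (xi_comp_ex R j)); pose ec j := sval (cid (eta_comp_ex R j)).
have xcP j : ag_hom (xc j) /\ forall P, xc j (K0cls P) = K0rc_cls (stdP j P).
  by rewrite /xc; case: cid.
have ecP j : ag_hom (ec j) /\ forall M, ec j (K0rc_cls M) = K0cls (headP j M).
  by rewrite /ec; case: cid.
pose comp (x : agpow4 (K0 R)) (j : obA) : K0 R :=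
  match j with a1 => x.1.1.1 | a2 => x.1.1.2 | a3 => x.1.2 | a4 => x.2 end.
pose xi x := ag_sum4 (fun j => xc j (comp x j)).
pose eta y : agpow4 (K0 R) := (ec a1 y, ec a2 y, ec a3 y, ec a4 y).
have xi_hom : ag_hom xi.
  move=> x y; rewrite -ag_sum4D; congr ag_sum4; apply: funext => j.
  by rewrite -(xcP j).1; case: j.
have eta_hom : ag_hom eta by move=> x y; rewrite /eta !(ecP _).1.
have diag j := eta_xi_diag (xcP j).1 (xcP j).2 (ecP j).1 (ecP j).2.
have off i j ij := @eta_xi_off R i j _ _ (xcP j).1 (xcP j).2 (ecP i).1 (ecP i).2 ij.
exists xi, eta; split=> [//|P1 P2 P3 P4|P|[[[x1 x2] x3] x4]|].
- by rewrite /xi /ag_sum4 /= !(xcP _).2.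
- by rewrite /eta !(ecP _).2.
- rewrite /eta /xi !(ag_hom_sum4 (ecP _).1) /ag_sum4 !diag.
  by rewrite !off // !(agD0, ag0D).
apply: (pres_hom_ext (f := xi \o eta) (g := id)) => [|//|P].
  exact: ag_hom_comp.
rewrite /= -[pgen _ P]/(K0rc_cls P) /xi /eta !(ecP _).2 [RHS]K0rc_decomposition.
by rewrite /ag_sum4 /= !(xcP _).2.
Qed.

Lemma iota_ex : exists f : Ugroup AAcat -> K0f R AAcat,
  ag_hom f /\ forall x : AAcat, f (Ucls x) = K0f_cls (RmorF R x).
Proof.
pose rep (c : eqclass (@ob_isom AAcat)) : AAcat := projT1 (cid (proj2_sig c)).
have rep_of x : rep (eqclass_of (@ob_isom AAcat) x) = x.
  rewrite /rep; case: cid => y /= e; apply/esym/AA_isom_eq; rewrite e.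
  by exists (idm y); exists (idm y); rewrite comp1m.
exists (@pres_lift _ (fun _ _ => False) (K0f R AAcat) (fun c => K0f_cls (RmorF R (rep c)))).
by split=> [|x]; [apply: pres_lift_hom | rewrite pres_lift_gen ?rep_of].
Qed.

Lemma psi_ex : exists f : K0f R AAcat -> Ugroup AAcat,
  ag_hom f /\ forall M : fgfreeRC R AAcat,
    f (K0f_cls M) = rank_class (fun x => Ucls (x : AAcat)) M.
Proof.
apply: groth_lift => [A B h|A B D h].
  by apply: rank_class_isom h => i; apply/head_fgfree/fgfrc_prop.
apply: rank_class_split => [i|i|]; try exact/head_fgfree/fgfrc_prop.
exact: fgproj_ses_rc_split (rc_fgfree_fgproj (fgfrc_prop D)) h.
Qed.

(** A free module is an iterated extension of representable modules. *)
Lemma K0f_cls_in_iota (M : fgfreeRC R AAcat) (f : Ugroup AAcat -> K0f R AAcat) :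
  ag_hom f -> (forall x : AAcat, f (Ucls x) = K0f_cls (RmorF R x)) ->
  hom_img f (K0f_cls M).
Proof.
move=> hf fE; have [s hs] := fgfrc_prop M.
pose S s := FgfreeRC (bigsum_fgfree R (C := AAcat) s).
rewrite (@K0f_isom R M (S s)) //; elim: s {M hs} => [|x s IH].
  suff -> : K0f_cls (S [::]) = ag0 by apply: hom_img0.
  apply/idem_ag0/K0f_split/isom_rc_split/rc_isom_sym/rc_dsum_zero/rc_zero0.
rewrite (@K0f_split R (RmorF R x) (S (x :: s)) (S s)).
  by apply: hom_imgD => //; exists (Ucls x).
exact: rc_split_dsum.
Qed.

Lemma iota_psi_inverse : exists (iota : Ugroup AAcat -> K0f R AAcat)
    (psi : K0f R AAcat -> Ugroup AAcat),
  [/\ ag_hom iota, forall x : AAcat, iota (Ucls x) = K0f_cls (RmorF R x),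
      ag_hom psi, forall M : fgfreeRC R AAcat,
        psi (K0f_cls M) = rank_class (fun x => Ucls (x : AAcat)) M
    & cancel iota psi /\ cancel psi iota].
Proof.
have [iota [hi iE]] := iota_ex; have [psi [hp pE]] := psi_ex.
have iK : cancel iota psi.
  apply: (pres_hom_ext (f := psi \o iota) (g := id)) => [|//|c].
    exact: ag_hom_comp.
  have [x ->] := eqclass_surj c.
  by rewrite /= -[pgen _ _]/(Ucls x) iE pE rank_class_Rmor.
have iota_surj z : hom_img iota z.
  apply: (hom_img_pres hi (e := fun z : K0f R AAcat => z)) => // M.
  exact: K0f_cls_in_iota.
exists iota, psi; split=> //; split=> // z.
by have [x <-] := iota_surj z; rewrite iK.
Qed.

Lemma forget_ex : exists F : K0f R AAcat -> K0rc R AAcat, ag_hom F /\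
  forall M : fgfreeRC R AAcat,
    F (K0f_cls M) = K0rc_cls (FgprojRC (rc_fgfree_fgproj (fgfrc_prop M))).
Proof.
apply: groth_lift => [A B h|A B D h]; first exact: K0rc_isom.
by exact: (@groth_gen_ses (fgprojRC R AAcat) _ _ (FgprojRC _) (FgprojRC _) (FgprojRC _) h).
Qed.

Section Pid.
Hypothesis pidR : is_pid R.

Lemma pid_head_free i (P : fgprojRC R AAcat) : lmod_fgfree (head i P).
Proof. exact/(pid_fgproj_free pidR)/(std_decomposition (fgprc_prop P)).1. Qed.

Lemma pid_psi_ex : exists f : K0rc R AAcat -> Ugroup AAcat,
  ag_hom f /\ forall M : fgprojRC R AAcat,
    f (K0rc_cls M) = rank_class (fun x => Ucls (x : AAcat)) M.
Proof.
apply: groth_lift => [A B h|A B D h].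
  by apply: rank_class_isom h => i; apply: pid_head_free.
apply: rank_class_split => [i|i|]; try exact: pid_head_free.
exact: fgproj_ses_rc_split (fgprc_prop D) h.
Qed.

Definition RoP : fgprojMod R := FgprojMod (fgfree_fgproj (Ro_fgfree R)).

(** Over a principal ideal domain, K_0(R) is generated by the class of R. *)
Lemma pid_K0_muln (P : fgprojMod R) : exists n, K0cls P = ag_muln (K0cls RoP) n.
Proof.
have [n hn] := pid_fgproj_free pidR (fgpm_prop P); exists n.
pose V m : fgprojMod R := FgprojMod (fgfree_fgproj (ex_intro _ m (lmod_isom_refl 'rV[R]_m))).
rewrite (@K0_isom R P (V n)) //; elim: n {P hn} => [|n IH].
  by apply: K0_zero => m; apply: thinmx0.
rewrite (@K0_split R RoP (V n.+1) (V n)) ?IH //.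
apply/isom_lsplit/lmod_isom_sym/(lmod_isom_trans _ (rV_prod R 1 n)).
exact: lmod_isom_prod (Ro_rV1 R) (lmod_isom_refl _).
Qed.

Variable F : K0f R AAcat -> K0rc R AAcat.
Hypothesis hF : ag_hom F.
Hypothesis FE : forall M : fgfreeRC R AAcat,
  F (K0f_cls M) = K0rc_cls (FgprojRC (rc_fgfree_fgproj (fgfrc_prop M))).

Lemma std_Ro_in_forget j : hom_img F (K0rc_cls (stdP j RoP)).
Proof.
pose Rm (x : AAcat) := FgprojRC (rc_fgfree_fgproj (Rmor_fgfree R x)).
have hRm x : hom_img F (K0rc_cls (Rm x)) by exists (K0f_cls (RmorF R x)).
have sub k A : rc_split (stdP k RoP) (Rm A) (Rm (a3 : AAcat)) ->
    hom_img F (K0rc_cls (stdP k RoP)).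
  move=> /K0rc_split e; have -> : K0rc_cls (stdP k RoP)
      = K0rc_cls (Rm A) + agN (K0rc_cls (Rm (a3 : AAcat))).
    by rewrite e -agDA agDN agD0.
  by apply: hom_imgD => //; apply: hom_imgN.
case: j.
- exact: sub (Rmor1_split R).
- exact: sub (Rmor2_split R).
- by rewrite (@K0rc_isom R _ (Rm (a3 : AAcat))) //; apply: ext_Rmor.
- by rewrite (@K0rc_isom R _ (Rm (a4 : AAcat))) //; apply: ext_Rmor.
Qed.

Lemma pid_forget_surj z : hom_img F z.
Proof.
apply: (hom_img_pres hF (e := fun z : K0rc R AAcat => z)) => // M.
rewrite -[pgen _ M]/(K0rc_cls M) K0rc_decomposition.
have im j Q : hom_img F (K0rc_cls (stdP j Q)).
  have [f [hf fE]] := xi_comp_ex R j; have [n e] := pid_K0_muln Q.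
  by rewrite -fE e ag_hom_muln // fE; apply/hom_img_muln/std_Ro_in_forget.
by do 3 ?apply: hom_imgD => //.
Qed.

(** The rank class on K_0(RA) restricts along F to the inverse of iota. *)
Lemma pid_forget_bij : bijective F.
Proof.
have [iota [psi [hi iE hp pE [_ psiK]]]] := iota_psi_inverse.
have [psi' [hp' pE']] := pid_psi_ex.
have e : psi' \o F =1 psi.
  apply: pres_hom_ext => [||M] //; first exact: ag_hom_comp.
  by rewrite /= -[pgen _ M]/(K0f_cls M) FE pE pE'.
have FK : cancel F (iota \o psi') by move=> x; rewrite /= [psi' _]e psiK.
exists (iota \o psi') => // z; have [x <-] := pid_forget_surj z.
by rewrite FK.
Qed.

End Pid.
End GrothendieckIsomorphisms.

Theorem theorem10p11 (R : comNzRingType) :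
  (exists (xi : agpow4 (K0 R) -> K0rc R AAcat)
          (eta : K0rc R AAcat -> agpow4 (K0 R)),
    [/\ ag_hom xi /\ ag_hom eta,
        forall P1 P2 P3 P4 : fgprojMod R,
          exists (h1 : rc_fgproj (K1 P1)) (h2 : rc_fgproj (K2 P2))
                 (h3 : rc_fgproj (extE (a3 : AAcat) P3))
                 (h4 : rc_fgproj (extE (a4 : AAcat) P4)),
            xi (K0cls P1, K0cls P2, K0cls P3, K0cls P4) =
            (K0rc_cls (FgprojRC h1) + K0rc_cls (FgprojRC h2)
             + K0rc_cls (FgprojRC h3) + K0rc_cls (FgprojRC h4))%AG,
        forall P : fgprojRC R AAcat,
          exists (h1 : lmod_fgproj (splitS (a1 : AAcat) P))
                 (h2 : lmod_fgproj (splitS (a2 : AAcat) P))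
                 (h3 : lmod_fgproj (coker (rc_act P (f34 : mor (a3 : AAcat) a4))))
                 (h4 : lmod_fgproj (splitS (a4 : AAcat) P)),
            eta (K0rc_cls P) =
            (K0cls (FgprojMod h1), K0cls (FgprojMod h2),
             K0cls (FgprojMod h3), K0cls (FgprojMod h4)),
        cancel xi eta
      & cancel eta xi]) /\
  (exists iota : Ugroup AAcat -> K0f R AAcat,
    [/\ ag_hom iota,
        forall x : AAcat, exists h : rc_fgfree (Rmor R x),
          iota (Ucls x) = K0f_cls (FgfreeRC h)
      & bijective iota]) /\
  (exists F : K0f R AAcat -> K0rc R AAcat,
    [/\ ag_hom F,
        forall M : fgfreeRC R AAcat, exists h : rc_fgproj M,
          F (K0f_cls M) = K0rc_cls (FgprojRC h)
      & is_pid R -> bijective F]).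
Proof.
split; [|split].
- have [xi [eta [hom xiE etaE xiK etaK]]] := xi_eta_inverse R; exists xi, eta; split=> //.
    move=> P1 P2 P3 P4.
    exists (std_fgproj a1 (fgpm_prop P1)), (std_fgproj a2 (fgpm_prop P2)),
           (std_fgproj a3 (fgpm_prop P3)), (std_fgproj a4 (fgpm_prop P4)).
    exact: xiE.
  move=> P; have [hP _] := std_decomposition (fgprc_prop P).
  exists (hP a1), (hP a2), (hP a3), (hP a4); rewrite etaE.
  by do ![congr pair]; apply: K0_isom; apply: lmod_isom_refl.
- have [iota [psi [hi iE _ _ [iK psiK]]]] := iota_psi_inverse R; exists iota; split=> //.
    by move=> x; exists (Rmor_fgfree R x); apply: iE.
  by exists psi.
- have [F [hF FE]] := forget_ex R; exists F; split=> //.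
    by move=> M; exists (rc_fgfree_fgproj (fgfrc_prop M)); apply: FE.
  by move=> pidR; apply: pid_forget_bij.
Qed.
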